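(* Let $X$ be an infinite Hausdorff space such that $\mathscr{F}(X)$ has at least one continuous selection, and let $p\in X_\Theta\setminus X_\Omega$. Then the connected component $\mathscr{C}[p]$ of $p$ in $X$ has a clopen base, and $p\in X_\Theta^*$.
   Context: All spaces are infinite Hausdorff topological spaces. $\mathscr{F}(X)$ is the set of all nonempty closed subsets of $X$, endowed with the Vietoris topology $\tau_V$, which is generated by the sets $\langle\mathscr{V}\rangle=\{S\in\mathscr{F}(X): S\subset\bigcup\mathscr{V}$ and $S\cap V\neq\varnothing$ for every $V\in\mathscr{V}\}$, where $\mathscr{V}$ runs over the finite families of open subsets of $X$. A selection for $\mathscr{F}(X)$ is a map $f:\mathscr{F}(X)\to X$ with $f(S)\in S$ for every $S\in\mathscr{F}(X)$; it is continuous if it is continuous with respect to $\tau_V$. $X_\Theta=\{f(X): f \text{ is a continuous selection for } \mathscr{F}(X)\}$. A point $p\in X$ is countably-approachable if it is either isolated or there is an open set $U\subset X\setminus\{p\}$ with $\overline{U}=U\cup\{p\}$ such that $p$ has a countable base of clopen sets in the subspace $\overline{U}$. $X_\Omega$ is the set of all countably-approachable points of $X$. A point $p\in X$ is selection maximal if there is a continuous selection $f$ for $\mathscr{F}(X)$ such that $f(S)=p$ for every $S\in\mathscr{F}(X)$ with $p\in S$; $X_\Theta^*=\{p\in X_\Theta: p \text{ is selection maximal}\}$. A closed subset $C\subset X$ has a clopen base if for every neighbourhood $U$ of $C$ there is a clopen set $H\subset X$ with $C\subset H\subset U$. *)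

(* Defs.v *)
From HB Require Import structures.
From mathcomp Require Import all_boot all_order all_algebra.
From mathcomp Require Import all_classical.
From mathcomp Require Import topology_structure subtype_topology connected.
From mathcomp Require Import separation_axioms.

Set Implicit Arguments.
Unset Strict Implicit.
Unset Printing Implicit Defensive.

Local Open Scope classical_set_scope.

Section Hyperspace.
Variable X : topologicalType.

Definition hyperspace : Type :=
  set_type [set S : set X | closed S /\ S !=set0].

HB.instance Definition _ := Choice.on hyperspace.

Definition hset (S : hyperspace) : set X := \val S.

Definition vietoris_set (V : set (set X)) : set hyperspace :=
  [set S | hset S `<=` \bigcup_(A in V) A /\
           forall A, V A -> hset S `&` A !=set0].

Definition finite_open_family : set (set (set X)) :=
  [set V | finite_set V /\ V `<=` open].

Lemma vietoris_cover :
  \bigcup_(V in finite_open_family) vietoris_set V = [set: hyperspace].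
Proof.
apply/seteqP; split=> // S _; exists [set setT].
  by split=> [|A ->]; [exact: finite_set1|exact: openT].
split=> [x _|A ->]; first by exists setT.
by rewrite setIT; have [_] := set_valP S.
Qed.

Lemma vietoris_join (V W : set (set X)) (S : hyperspace) :
  finite_open_family V -> finite_open_family W ->
  vietoris_set V S -> vietoris_set W S ->
  exists U, [/\ finite_open_family U, vietoris_set U S &
    vietoris_set U `<=` vietoris_set V `&` vietoris_set W].
Proof.
move=> [finV opV] [finW opW] [SV VS] [SW WS].
pose cV := \bigcup_(A in V) A; pose cW := \bigcup_(A in W) A.
have ocV : open cV by apply: bigcup_open => A /opV.
have ocW : open cW by apply: bigcup_open => A /opW.
exists ((fun A => A `&` cW) @` V `|` (fun A => A `&` cV) @` W); split.
- split; first by rewrite finite_setU; split; exact: finite_image.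
  by move=> _ [] [A AVW <-]; apply: openI => //; [exact: opV|exact: opW].
- split=> [x Sx|_ [] [A AVW <-]].
  + have [A VA Ax] := SV _ Sx.
    by exists (A `&` cW); [left; exists A|split=> //; exact: SW].
  + by have [x [Sx Ax]] := VS _ AVW; exists x; split=> //; split=> //; exact: SW.
  + by have [x [Sx Ax]] := WS _ AVW; exists x; split=> //; split=> //; exact: SV.
- move=> T [TU UT]; split; split.
  + by move=> x /TU [_ [] [A AVW <-] [Ax //]]; exists A.
  + move=> A VA; have [|x [Tx [Ax _]]] := UT (A `&` cW); last by exists x.
    by left; exists A.
  + by move=> x /TU [_ [] [A AVW <-] [Ax //]]; exists A.
  + move=> A WA; have [|x [Tx [Ax _]]] := UT (A `&` cV); last by exists x.
    by right; exists A.
Qed.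

HB.instance Definition _ := @isBaseTopological.Build hyperspace
  (set (set X)) finite_open_family vietoris_set vietoris_cover vietoris_join.

Definition selection (f : hyperspace -> X) := forall S, hset S (f S).

Definition continuous_selection (f : hyperspace -> X) :=
  selection f /\ continuous f.

(* [X] need not be pointed: [S] is the whole space seen as a point of the
   hyperspace, which exists exactly when [X] is nonempty. *)
Definition X_Theta : set X :=
  [set p | exists f, continuous_selection f /\
             exists2 S : hyperspace, hset S = [set: X] & f S = p].

Definition selection_maximal (p : X) :=
  exists2 f, continuous_selection f &
    forall S : hyperspace, hset S p -> f S = p.

Definition X_Theta_star : set X := X_Theta `&` selection_maximal.

End Hyperspace.

Arguments X_Theta : clear implicits.
Arguments X_Theta_star : clear implicits.

Definition countable_clopen_base_at (T : topologicalType) (x : T) :=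
  exists B : set (set T), [/\ countable B,
    forall V, B V -> clopen V /\ V x &
    forall W, nbhs x W -> exists2 V, B V & V `<=` W].

(* The coercion of [closure U] to a type carries the subspace topology; [q] is
   [p] seen as a point of that subspace. *)
Definition countably_approachable (X : topologicalType) (p : X) :=
  isolated [set: X] p \/
  exists U : set X, [/\ open U, U `<=` ~` [set p],
    closure U = U `|` [set p] &
    exists2 q : closure U, \val q = p & countable_clopen_base_at q].

Definition X_Omega (X : topologicalType) : set X :=
  [set p | countably_approachable p].
Arguments X_Omega : clear implicits.

Definition has_clopen_base (X : topologicalType) (C : set X) :=
  closed C /\
  forall U, set_nbhs C U -> exists H, [/\ clopen H, C `<=` H & H `<=` U].

(* Main.v *)
Require Import Defs.
From mathcomp Require Import all_boot all_order all_algebra.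
From mathcomp Require Import all_classical.
From mathcomp Require Import topology_structure initial_topology subtype_topology.
From mathcomp Require Import connected separation_axioms.

(** Let [f] be a continuous selection with [f X = p], where [p] is not countably
approachable, and let [C] be the component of [p]. Continuity of [f] at [X]
means that [f] takes values near [p] on all closed sets that are close to [X];
the whole argument exploits this along families of closed sets increasing to
[X].

Two tools are used throughout. First, selections produce clopen sets: for closed
[D] and clopen [R] with [f D] outside [R], the set of those [x] in [R] with [f
(D U {x}) = x] is clopen ([clopen_fix]). Already for singletons [D] this shows
that [C] is a quasi-component and meets the closure of its complement in at most
two points. Secondly, if a variable part of a closed set moves inside a
connected set, the selected value cannot jump between two disjoint closed sets
([sel_move]). Together, they show that a clopen condition on [f] that holds at
one point of [C] holds for all closed subsets of a neighbourhood of [C]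
([sel_near]).

That [p] is not countably approachable is used only through
[sel_limit_approachable]. Suppose that every point of [X] lies in all but
finitely many of the closed sets [Y_n], that [K_n] are decreasing clopen
neighbourhoods of [p], that [Y_n] contains [p] and the complement of [K_n], and
that [f Y_n] lies outside [K_n]. The values [f Y_n] tend to [p], hence, along a
subsequence, lie in disjoint clopen rings [K_m \ K_n]; [clopen_fix] turns them
into nonempty clopen subsets of these rings, which still converge to [p], and
[p] is countably approachable. Every configuration excluded below is excluded
because it would produce such a sequence.

This gives a clopen base of [C] ([clopen_base_component]), and even one made of
tame sets [H], for which subsets of [C] win over the complement of [H]
([tame_base]). Passing to the limit, every closed [F] inside [C] is selected
from the union of [F] and [closure (~ C)] ([component_prevails]); singletons [F]
then show that [C] has at most one boundary point [z].

For the maximality of [p], a transfinite descending tower of closed sets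
containing [C] is built, starting with [X]: closed subsets of each new member
win against the complement of the preceding one. This is a closed condition, so
it passes to the intersections taken at limit stages. The tower stops at a set
equal to [C] up to a clopen set [V] disjoint from [C] ([bot_diff_clopen]). A
closed set [S] missing [C] and [V] has a last member [E] of the tower that it
meets, and the new selection chooses in [S n E] the point that [f] picks against
the complement of the members of the tower above [E]. A closed set that meets
[C] is treated by the selection [F |-> f (closure (~ C) U F)] on closed subsets
of [C]; as it sends [C] to [p] and [C] is connected, it sends to [p] every set
containing [p] ([sel_maximal]). Both recipes agree at the only place where they
meet, the boundary point [z]. *)

Set Implicit Arguments.
Unset Strict Implicit.
Unset Printing Implicit Defensive.

Local Open Scope classical_set_scope.

(** * Topological preliminaries *)
Lemma set_seq_cons (T : eqType) (x : T) (s : seq T) :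
  [set` x :: s] = [set x] `|` [set` s].
Proof.
apply/seteqP; split=> y /=; rewrite inE; first by move=> /orP[/eqP ->|];
  [left|right].
by move=> [->|->]; rewrite ?eqxx ?orbT.
Qed.

Lemma hausdorff_closed1 (X : topologicalType) (x : X) :
  hausdorff_space X -> closed [set x].
Proof. by move=> hX; apply: accessible_closed_set1;
  exact: hausdorff_accessible. Qed.

Lemma closed_seq (X : topologicalType) (s : seq X) :
  hausdorff_space X -> closed [set` s].
Proof.
move=> hX; elim: s => [|x s IH]; first by rewrite classical_sets.set_nil;
  exact: closed0.
by rewrite set_seq_cons; apply: closedU => //; exact: hausdorff_closed1.
Qed.

Lemma set1_ne (T : Type) (x : T) : [set x] !=set0. Proof. by exists x. Qed.
#[local] Hint Resolve set1_ne : core.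

Lemma setU1_ne (T : Type) (Y : set T) x : Y `|` [set x] !=set0.
Proof. by exists x; right. Qed.

Lemma hausdorff_sep (X : topologicalType) (x y : X) :
  hausdorff_space X -> x <> y ->
  exists U V, [/\ open U, open V, U x, V y & forall z, U z -> V z -> False].
Proof.
rewrite open_hausdorff => hX /eqP xy.
have [[U V] [/= + +] [oU oV /eqP UV]] := hX _ _ xy.
rewrite !inE => Ux Vy; exists U, V; split=> // z Uz Vz.
by have : (U `&` V) z by []; rewrite UV.
Qed.

Lemma open_local (X : topologicalType) (A : set X) :
  (forall x, A x -> exists O, [/\ open O, O x & O `<=` A]) -> open A.
Proof.
move=> HA; rewrite openE => x /HA[O [oO Ox OA]].
by rewrite /interior nbhsE; exists O.
Qed.

Lemma clopen_setC (X : topologicalType) (A : set X) : clopen A -> clopen (~` A).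
Proof. by move=> clA; exact: (clopenC set0 clA). Qed.

Lemma closure_meet (X : topologicalType) (A O : set X) x :
  closure A x -> open O -> O x -> A `&` O !=set0.
Proof. by move=> clx oO Ox; apply: clx; exact: open_nbhs_nbhs. Qed.

Lemma closureC_or_interior (X : topologicalType) (A : set X) x :
  closure (~` A) x \/ A° x.
Proof.
by have [|] := pselect (closure (~` A) x); [left|right;
  rewrite -[A]setCK interiorC].
Qed.

(** Connectedness is used below through pairs of closed sets given by continuity
of the selection, which cover [C] and are disjoint on [C]. *)
Lemma connected_closed2P (X : topologicalType) (C : set X) :
  connected C <-> forall K1 K2, closed K1 -> closed K2 -> C `<=` K1 `|` K2 ->
    (forall x, C x -> K1 x -> K2 x -> False) -> C `&` K1 !=set0 -> C `<=` K1.
Proof.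
split=> [coC K1 K2 cK1 cK2 CK dK CK1|CK B B0 [O oO BO] [K cK BK]].
  suff <- : C `&` K1 = C by move=> x [].
  apply: coC => //; last by exists K1.
  exists (~` K2); first exact: closed_openC.
  apply/seteqP; split=> x [Cx Kx]; split=> //; first by move/(dK _ Cx Kx).
  by have [] := CK _ Cx.
apply/seteqP; split=> x; first by rewrite BO => -[].
move=> Cx; rewrite BK; split=> //.
apply: (CK K (~` O)) => //; first exact: open_closedC.
- move=> y Cy; have [Oy|nOy] := pselect (O y); last by right.
  by left; have : (C `&` O) y by []; rewrite -BO BK => -[].
- move=> y Cy Ky; apply.
  by have : (C `&` K) y by []; rewrite -BK BO => -[].
- by rewrite -BK.
Qed.

(** Both closed halves of a connected set cut at a single point are connected:
the other half can be added to whichever part contains the cut point. *)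
Lemma connected_half (X : topologicalType) (C A B : set X) x :
  connected C -> closed A -> closed B -> C = A `|` B -> A `&` B = [set x] ->
  connected A.
Proof.
move=> /connected_closed2P coC cA cB CAB ABx.
have [Ax Bx] : (A `&` B) x by rewrite ABx.
suff H K1 K2 : closed K1 -> closed K2 -> A `<=` K1 `|` K2 ->
    (forall y, A y -> K1 y -> K2 y -> False) -> K1 x -> A `<=` K1.
  apply/connected_closed2P => K1 K2 cK1 cK2 AK dK [y [Ay K1y]].
  have [K1x|K2x] := AK _ Ax; first exact: (H K1 K2).
  case: (dK y) => //; apply: (H K2 K1) => // [z /AK[]|z Az K2z K1z].
  - by right.
  - by left.
  - exact: (dK z).
move=> cK1 cK2 AK dK K1x y Ay.
have : ((A `&` K1) `|` B) y.
  apply: (coC _ (A `&` K2)); rewrite ?CAB.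
  - by apply: closedU => //; exact: closedI.
  - exact: closedI.
  - by move=> z [Az|Bz]; [have [] := AK _ Az; [left; left|right]|left; right].
  - move=> z _ [[_ K1z]|Bz] [Az K2z]; first exact: (dK z).
    have : (A `&` B) z by [].
    by rewrite ABx => zx; move: K2z; rewrite zx; exact: dK.
  - by exists x; split; left.
  - by left.
case=> [[]//|By]; have : (A `&` B) y by [].
by rewrite ABx => ->.
Qed.

(** * Vietoris neighbourhoods of closed sets *)
Section VietorisNeighbourhoods.
Variable X : topologicalType.
Implicit Types (A B E F G N O S V Y : set X) (P : set X -> Prop) (s : seq X).

(** Neighbourhoods for the Vietoris topology, written on plain sets: a single
open set [G] bounds from above and finitely many open sets must be met. The
point [A] of the hyperspace being a mere set spares all the dependent types;
[vnear_hyperspace] relates the two. *)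
Definition vnear A P := exists G (Vs : seq (set X)),
  [/\ open G, A `<=` G, forall V, V \in Vs -> open V /\ A `&` V !=set0 &
   forall B, closed B -> B !=set0 -> B `<=` G ->
     (forall V, V \in Vs -> B `&` V !=set0) -> P B].

Lemma vnear_mono A P P' :
  (forall B, closed B -> B !=set0 -> P B -> P' B) -> vnear A P -> vnear A P'.
Proof.
move=> PP' [G [Vs [oG AG AVs BP]]]; exists G, Vs; split=> // B cB B0 BG BVs.
by apply: PP' => //; exact: BP.
Qed.

Lemma vnear_and A P P' :
  vnear A P -> vnear A P' -> vnear A (fun B => P B /\ P' B).
Proof.
move=> [G [Vs [oG AG AVs BP]]] [G' [Vs' [oG' AG' AVs' BP']]].
exists (G `&` G'), (Vs ++ Vs'); split.
- exact: openI.
- by move=> x Ax; split; [exact: AG|exact: AG'].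
- by move=> V; rewrite mem_cat => /orP[/AVs|/AVs'].
- move=> B cB B0 BGG' BV; split.
  + by apply: BP => // [x /BGG' []//|V VVs]; apply: BV; rewrite mem_cat VVs.
  + by apply: BP' => // [x /BGG' []//|V VVs]; apply: BV; rewrite mem_cat VVs orbT.
Qed.

Lemma vnear_sub A G : open G -> A `<=` G -> vnear A (fun B => B `<=` G).
Proof. by move=> oG AG; exists G, [::]; split. Qed.

Lemma vnear_meet A V : open V -> A `&` V !=set0 ->
  vnear A (fun B => B `&` V !=set0).
Proof.
move=> oV AV; exists setT, [:: V]; split=> //; first exact: openT.
- by move=> W; rewrite inE => /eqP ->.
- by move=> B _ _ _; apply; rewrite inE.
Qed.

(** An upward directed family with union dense in [A] converges to [A],
uniformly for the sets between its members and [A]. All the limits below, over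
finite sets, over clopen sets and along the tower, are of this form. *)
Lemma vnear_limit (D : set (set X)) A P :
  D !=set0 -> (forall E F, D E -> D F -> exists2 G, D G & E `|` F `<=` G) ->
  A `<=` closure (\bigcup_(E in D) E) -> vnear A P ->
  exists2 E, D E &
    forall B, closed B -> B !=set0 -> E `<=` B -> B `<=` A -> P B.
Proof.
move=> [E0 DE0] Ddir AD [G [Vs [oG AG AVs BP]]].
suff [E DE EVs] : exists2 E, D E & forall V, V \in Vs -> E `&` V !=set0.
  exists E => // B cB B0 EB BA; apply: BP => // [x /BA/AG//|V /EVs[x [Ex Vx]]].
  by exists x; split=> //; exact: EB.
elim: Vs AVs {BP} => [|V Vs IH] AVs; first by exists E0.
have [|E DE EVs] := IH; first by move=> W WVs; apply: AVs; rewrite inE WVs orbT.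
have [oV [x [/AD clx Vx]]] := AVs V (mem_head _ _).
have [y [[E' DE' E'y] Vy]] := clx V (open_nbhs_nbhs (conj oV Vx)).
have [E'' DE'' EE''] := Ddir _ _ DE DE'.
exists E'' => // W; rewrite inE => /orP[/eqP ->|/EVs[z [Ez Wz]]].
  by exists y; split=> //; apply: EE''; right.
by exists z; split=> //; apply: EE''; left.
Qed.

Lemma vnear_finite Y F L P :
  closed Y -> hausdorff_space X -> L !=set0 -> L `<=` F -> F `<=` closure L ->
  vnear (Y `|` F) P ->
  exists s, [/\ [set` s] !=set0, [set` s] `<=` L & P (Y `|` [set` s])].
Proof.
move=> cY hX [x0 Lx0] LF FL PYF.
pose D := [set Y `|` [set` s] | s in [set s : seq X | [set` s] !=set0 /\ [set` s]
  `<=` L]].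
have [|||_ [s [s0 sL] <-] HP] := @vnear_limit D _ P _ _ _ PYF.
- exists (Y `|` [set` [:: x0]]); exists [:: x0] => //; split.
    by exists x0; rewrite /= inE.
  by move=> y; rewrite /= inE => /eqP ->.
- move=> _ _ [s [s0 sL] <-] [t [t0 tL] <-].
  exists (Y `|` [set` s ++ t]).
    exists (s ++ t) => //; split.
      by have [x xs] := s0; exists x; rewrite /= mem_cat xs.
    by move=> y; rewrite /= mem_cat => /orP[/sL|/tL].
  move=> y [[Yy|ys]|[Yy|yt]]; [by left|right|by left|right].
    by rewrite /= mem_cat ys.
  by rewrite /= mem_cat yt orbT.
- have YD : Y `<=` \bigcup_(E in D) E.
    move=> y Yy; exists (Y `|` [set` [:: x0]]); last by left.
    exists [:: x0] => //; split; first by exists x0; rewrite /= inE.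
    by move=> z; rewrite /= inE => /eqP ->.
  have LD : L `<=` \bigcup_(E in D) E.
    move=> y Ly; exists (Y `|` [set` [:: y]]); last by right; rewrite /= inE.
    exists [:: y] => //; split; first by exists y; rewrite /= inE.
    by move=> z; rewrite /= inE => /eqP ->.
  move=> y [/YD/subset_closure//|/FL]; exact: closureS.
exists s; split=> //; apply: HP => //.
- by apply: closedU => //; exact: closed_seq.
- by have [x xs] := s0; exists x; right.
- by move=> y [Yy|/sL/LF Fy]; [left|right].
Qed.

(** Around [Y U {b1, b2}], sets of the form [Y U F] are close as soon as [F]
consists of points close to [b1] or [b2] and has points of both kinds. *)
Lemma vnear_two_points Y b1 b2 P : closed Y ->
  vnear (Y `|` ([set b1] `|` [set b2])) P ->
  exists W1 W2, [/\ open W1, open W2, W1 b1, W2 b2 &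
    forall F, closed F -> F `<=` W1 `|` W2 -> F `&` W1 !=set0 ->
      F `&` W2 !=set0 -> P (Y `|` F)].
Proof.
move=> cY [G [Vs [oG YG YVs HP]]].
have [b|W HW] := @choice X (set X)
    (fun b W => open W /\ (G b -> [/\ W `<=` G, W b &
       forall V, V \in Vs -> V b -> W `<=` V])).
  have [Gb|nGb] := pselect (G b); last by exists set0; split=> //; exact: open0.
  suff [W [oW Wb WV]] : exists W, [/\ open W, W b &
      forall V, V \in Vs -> V b -> W `<=` V].
    exists (G `&` W); split; first exact: openI.
    by move=> _; split=> [x []//||V VVs Vb x [_ Wx]]; [split|exact: (WV V)].
  elim: Vs YVs {HP} => [|V Vs IH] YVs.
    by exists setT; split=> //; exact: openT.
  have [|W [oW Wb WV]] := IH.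
    by move=> V' V'Vs; apply: YVs; rewrite inE V'Vs orbT.
  have [Vb|nVb] := pselect (V b).
    exists (V `&` W); split=> //; first apply: openI => //.
      by have [] := YVs V (mem_head _ _).
    move=> V'; rewrite inE => /orP[/eqP -> _ x []//|V'Vs V'b x [_ Wx]].
    exact: (WV V').
  exists W; split=> // V'; rewrite inE => /orP[/eqP ->//|V'Vs V'b].
  exact: WV.
have Gb1 : G b1 by apply: YG; right; left.
have Gb2 : G b2 by apply: YG; right; right.
have [oW1 /(_ Gb1)[W1G W1b1 W1V]] := HW b1.
have [oW2 /(_ Gb2)[W2G W2b2 W2V]] := HW b2.
exists (W b1), (W b2); split=> // F cF FW [x1 [Fx1 Wx1]] [x2 [Fx2 Wx2]].
apply: HP.
- exact: closedU.
- by exists x1; right.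
- by move=> y [Yy|/FW[/W1G|/W2G]//]; apply: YG; left.
- move=> V VVs; have [_ [y [[Yy|[yb|yb]] Vy]]] := YVs _ VVs.
  + by exists y; split=> //; left.
  + by exists x1; split; [right|apply: (W1V V) => //; rewrite -yb].
  + by exists x2; split; [right|apply: (W2V V) => //; rewrite -yb].
Qed.

(** Cutting by [E] is not a continuous operation, since points of a nearby set
may leave [E]. It becomes continuous once a closed set [N] containing the
boundary of [E] is added, as long as something is left in [E]. *)
Lemma vnear_cut N E S P : closed N -> closed E -> E `<=` N `|` E° ->
  vnear (N `|` (S `&` E)) P ->
  vnear S (fun B => B `&` E !=set0 -> P (N `|` (B `&` E))).
Proof.
move=> cN cE EN [G [Vs [oG NSG NSVs HP]]].
exists (G `|` ~` E), [seq V `&` E° | V <- Vs & ~~ `[< N `&` V !=set0 >]]; split.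
- by apply: openU => //; exact: closed_openC.
- move=> x Sx; have [Ex|] := pselect (E x); last by right.
  by left; apply: NSG; right.
- move=> _ /mapP[V + ->]; rewrite mem_filter => /andP[/asboolPn nNV VVs].
  have [oV [x [NSx Vx]]] := NSVs _ VVs; split.
    by apply: openI => //; exact: open_interior.
  case: NSx => [Nx|[Sx Ex]]; first by case: nNV; exists x.
  have [Nx|Eox] := EN _ Ex; first by case: nNV; exists x.
  by exists x.
- move=> B cB B0 BG BV [y [By Ey]]; apply: HP.
  + by apply: closedU => //; exact: closedI.
  + by exists y; right.
  + move=> x [Nx|[/BG[//|nEx] Ex]//]; by apply: NSG; left.
  + move=> V VVs; have [[x [Nx Vx]]|nNV] := pselect (N `&` V !=set0).
      by exists x; split=> //; left.
    have [|x [Bx [Vx Eox]]] := BV (V `&` E°).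
      by apply/mapP; exists V => //; rewrite mem_filter VVs andbT; apply/asboolPn.
    by exists x; split=> //; right; split=> //; exact: interior_subset.
Qed.

End VietorisNeighbourhoods.

(** * Moving points inside connected sets *)
Section Selections.
Variable X : topologicalType.
Hypothesis hX : hausdorff_space X.
Variable f : set X -> X.
Implicit Types (x y z : X) (A B C D F G H K M O U V W Y : set X) (P : set X ->
  Prop).

Definition set_selection := forall A, closed A -> A !=set0 -> A (f A).
Definition set_continuous := forall A O,
  closed A -> A !=set0 -> open O -> O (f A) -> vnear A (fun B => O (f B)).

Hypothesis f_sel : set_selection.
Hypothesis f_cont : set_continuous.

Let c1 (x : X) : closed [set x]. Proof. exact: hausdorff_closed1. Qed.

#[local] Hint Resolve c1 : core.

(** Closed conditions on the selected value need only be checked on finite sets.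
*)
Lemma sel_dense Y F L K : closed Y -> closed F -> closed K ->
  L !=set0 -> L `<=` F -> F `<=` closure L ->
  (forall s : seq X, [set` s] !=set0 -> [set` s] `<=` L ->
     K (f (Y `|` [set` s]))) ->
  K (f (Y `|` F)).
Proof.
move=> cY cF cK [x0 Lx0] LF FL HK; apply: contrapT => nK.
have [||s [s0 sL]] := @vnear_finite _ Y F L (fun B => (~` K) (f B)) cY hX _ LF FL.
- by exists x0.
- apply: f_cont => //; [exact: closedU| |exact: closed_openC].
  by exists x0; right; exact: LF.
- by apply; exact: HK.
Qed.

Lemma open_sel1 Y O : closed Y -> open O -> open [set x | O (f (Y `|` [set x]))].
Proof.
move=> cY oO; apply: open_local => x /= Ofx.
have := @f_cont (Y `|` [set x]) O (closedU cY (@c1 x)) (setU1_ne _ _) oO Ofx.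
rewrite -[in vnear _](setUid [set x]).
move=> /(vnear_two_points cY)[W1 [W2 [oW1 oW2 W1x W2x HW]]].
exists (W1 `&` W2); split=> //; first exact: openI.
move=> y [W1y W2y]; apply: HW => //; first by move=> _ ->; left.
- by exists y.
- by exists y.
Qed.

Lemma closed_sel1 Y K : closed Y -> closed K ->
  closed [set x | K (f (Y `|` [set x]))].
Proof.
move=> cY cK; rewrite -openC; apply: (@open_sel1 Y (~` K)) => //.
exact: closed_openC.
Qed.

Lemma closed_fix Y : closed Y -> closed [set x | f (Y `|` [set x]) = x].
Proof.
move=> cY; rewrite -openC; apply: open_local => x /= /eqP/eqP fx.
have [U [V [oU oV Ufx Vx UV]]] := hausdorff_sep hX fx.
exists (V `&` [set y | U (f (Y `|` [set y]))]); split=> //.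
  by apply: openI => //; exact: open_sel1.
by move=> y [Vy Ufy] fy; apply: (UV y); rewrite // -[in U _]fy.
Qed.

(** The source of clopen sets. Both [f (Y U {x}) = x] and [f (Y U {x}) \in Y]
are closed conditions on [x]; together they exhaust everything and they can only
hold together at the point [f Y]. *)
Lemma clopen_fix R Y : clopen R -> closed Y -> Y !=set0 -> ~ R (f Y) ->
  clopen [set x | R x /\ f (Y `|` [set x]) = x].
Proof.
move=> [oR cR] cY Y0 nRfY; split; last first.
  by rewrite (_ : mkset _ = R `&` [set x | f (Y `|` [set x]) = x]) //;
     apply: closedI => //; exact: closed_fix.
rewrite (_ : mkset _ = R `&` ~` [set x | Y (f (Y `|` [set x]))]).
  by apply: openI => //; apply: closed_openC; exact: closed_sel1.
apply/seteqP; split=> x /= [Rx].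
  move=> fx; split=> // Yfx; apply: nRfY.
  have Yx : Y x by rewrite -fx.
  suff <- : Y `|` [set x] = Y by rewrite fx.
  by apply/seteqP; split=> y; [case=> // ->|left].
move=> nYf; split=> //.
have [//|//] := f_sel (closedU cY (@c1 x)) (setU1_ne Y x).
Qed.

Section Moving.
Variables (C Y : set X).
Hypotheses (coC : connected C) (cY : closed Y).

Let move1 K1 K2 F c c' : closed K1 -> closed K2 ->
  (forall x, K1 x -> K2 x -> False) ->
  (forall F, closed F -> F !=set0 -> F `<=` C -> (K1 `|` K2) (f (Y `|` F))) ->
  closed F -> F `<=` C -> C c -> C c' ->
  K1 (f (Y `|` (F `|` [set c]))) -> K1 (f (Y `|` (F `|` [set c']))).
Proof.
move=> cK1 cK2 dK YK cF FC Cc Cc' Kc.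
have cYF : closed (Y `|` F) by exact: closedU.
suff : C `<=` [set x | K1 (f ((Y `|` F) `|` [set x]))].
  by move=> /(_ _ Cc') /=; rewrite -setUA.
move/connected_closed2P: coC => H.
apply: (H _ [set x | K2 (f ((Y `|` F) `|` [set x]))]).
- exact: closed_sel1.
- exact: closed_sel1.
- move=> x Cx; change ((K1 `|` K2) (f ((Y `|` F) `|` [set x]))).
  rewrite -setUA; apply: YK.
  + exact: closedU.
  + exact: setU1_ne.
  + by move=> y [/FC//|->].
- by move=> x _ /=; exact: dK.
- by exists c; split=> //=; rewrite -setUA.
Qed.

Let move2 K1 K2 c F : closed K1 -> closed K2 ->
  (forall x, K1 x -> K2 x -> False) ->
  (forall F, closed F -> F !=set0 -> F `<=` C -> (K1 `|` K2) (f (Y `|` F))) ->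
  closed F -> F !=set0 -> F `<=` C -> C c ->
  K1 (f (Y `|` [set c])) -> K1 (f (Y `|` F)).
Proof.
move=> cK1 cK2 dK YK cF F0 FC Cc Kc.
apply: (@sel_dense Y F F K1) => //.
  exact: subset_closure.
elim=> [[x //]|x s IH _ sF].
have Cx : C x by apply/FC/sF; rewrite /= inE eqxx.
rewrite set_seq_cons (setUC [set x]).
case: s IH sF => [_ _|y s IH sF].
  rewrite classical_sets.set_nil; apply: (@move1 K1 K2 set0 c x) => //;
    first exact: closed0.
  by rewrite set0U.
have sC : [set` y :: s] `<=` C by move=> z zs; apply/FC/sF; rewrite /= inE zs orbT.
have Cy : C y by apply: sC; rewrite /= inE eqxx.
apply: (@move1 K1 K2 [set` y :: s] y x) => //; first exact: closed_seq.
rewrite (_ : _ `|` [set y] = [set` y :: s]); last first.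
  by apply/seteqP; split=> z; [case=> // ->; rewrite /= inE eqxx|left].
apply: IH; first by exists y; rewrite /= inE eqxx.
by move=> z zs; apply: sF; rewrite /= inE zs orbT.
Qed.

(** If [K1] and [K2] are disjoint closed sets and the value always lies in one
of them, then it stays in the same one while one point at a time is moved, added
or removed inside the connected set [C]. *)
Lemma sel_move K1 K2 F0 F : closed K1 -> closed K2 ->
  (forall x, K1 x -> K2 x -> False) ->
  (forall F, closed F -> F !=set0 -> F `<=` C -> (K1 `|` K2) (f (Y `|` F))) ->
  closed F0 -> F0 !=set0 -> F0 `<=` C -> closed F -> F !=set0 -> F `<=` C ->
  K1 (f (Y `|` F0)) -> K1 (f (Y `|` F)).
Proof.
move=> cK1 cK2 dK YK cF0 F00 F0C cF Fn FC KF0.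
have [c Fc] := F00; have Cc := F0C _ Fc.
apply: (@move2 K1 K2 c) => //.
have [|||//|K2c] := YK [set c] => //; first by move=> _ ->.
case: (dK _ KF0).
apply: (@move2 K2 K1 c) => //; first by move=> x K2x K1x; exact: (dK x).
by move=> G cG Gn GC; have [] := YK G cG Gn GC; [right|left].
Qed.

Lemma sel_move_clopen K F0 F : clopen K ->
  closed F0 -> F0 !=set0 -> F0 `<=` C -> closed F -> F !=set0 -> F `<=` C ->
  K (f (Y `|` F0)) -> K (f (Y `|` F)).
Proof.
move=> [oK cK]; apply: (@sel_move K (~` K)) => //; first exact: open_closedC.
by move=> G _ _ _; exact: EM.
Qed.

End Moving.

(** [C] need not be compact, so continuity at the sets [Y U F] with [F] inside
[C] gives no uniform neighbourhood of [C]. It is enough, however, to control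
points near the two boundary points [b1] and [b2]: the rest of [F] lies in [C]
and is handled by [sel_move]. *)
Lemma sel_near C Y K b1 b2 c : connected C -> closed Y -> closed C -> C b1 -> C
  b2 ->
  (forall x, C x -> closure (~` C) x -> x = b1 \/ x = b2) ->
  clopen K -> C c -> K (f (Y `|` [set c])) ->
  exists W, [/\ open W, C `<=` W &
    forall F, closed F -> F !=set0 -> F `<=` W -> K (f (Y `|` F))].
Proof.
move=> coC cY cC Cb1 Cb2 bdC clK Cc Kc.
have near2 x y : C x -> C y -> exists W1 W2, [/\ open W1, open W2, W1 x, W2 y &
    forall F, closed F -> F `<=` W1 `|` W2 -> F `&` W1 !=set0 ->
      F `&` W2 !=set0 -> K (f (Y `|` F))].
  move=> Cx Cy; apply: (vnear_two_points (P := fun B => K (f B))) => //.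
  apply: (@f_cont _ K).
  - by apply: closedU => //; exact: closedU.
  - by exists x; right; left.
  - by case: clK.
  - apply: (@sel_move_clopen C Y coC cY K [set c]) => //; first by move=> _ ->.
    + exact: closedU.
    + by exists x; left.
    + by move=> _ [] ->.
have [U1 [U1' [oU1 oU1' U1b U1'b HU1]]] := near2 b1 b1 Cb1 Cb1.
have [U2 [U2' [oU2 oU2' U2b U2'b HU2]]] := near2 b2 b2 Cb2 Cb2.
have [V1 [V2 [oV1 oV2 V1b V2b HV]]] := near2 b1 b2 Cb1 Cb2.
pose W1 := U1 `&` U1' `&` V1; pose W2 := U2 `&` U2' `&` V2.
have KW F : closed F -> F !=set0 -> F `<=` W1 `|` W2 -> K (f (Y `|` F)).
  move=> cF [x Fx] FW.
  have [[y1 [Fy1 W1y]]|F1] := pselect (F `&` W1 !=set0); last first.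
    have FW2 y : F y -> W2 y.
      by move=> Fy; have [W1y|//] := FW _ Fy; case: F1; exists y.
    apply: HU2 => //; [move=> y /FW2[[]]; by left|exists x|exists x].
      by have [[]] := FW2 _ Fx.
    by have [[]] := FW2 _ Fx.
  have [[y2 [Fy2 W2y]]|F2] := pselect (F `&` W2 !=set0); last first.
    have FW1 y : F y -> W1 y.
      by move=> Fy; have [//|W2y] := FW _ Fy; case: F2; exists y.
    apply: HU1 => //; [move=> y /FW1[[]]; by left|exists x|exists x].
      by have [[]] := FW1 _ Fx.
    by have [[]] := FW1 _ Fx.
  apply: HV => //.
  - by move=> y /FW[[]|[]]; [left|right].
  - by exists y1; case: W1y.
  - by exists y2; case: W2y.
exists (~` closure (~` C) `|` (W1 `|` W2)); split.
- apply: openU; first by apply: closed_openC; exact: closed_closure.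
  by apply: openU; apply: openI => //; exact: openI.
- move=> x Cx; have [clx|] := pselect (closure (~` C) x); last by left.
  by right; have [->|->] := bdC _ Cx clx; [left|right].
move=> F cF F0 FW.
pose F1 := F `&` closure (~` C); pose F2 := F `&` C.
have cF1 : closed F1 by apply: closedI => //; exact: closed_closure.
have cF2 : closed F2 by exact: closedI.
have F1W : F1 `<=` W1 `|` W2 by move=> x [/FW[]].
have FE : F = F1 `|` F2.
  apply/seteqP; split=> [x Fx|x [] []//].
  have [Cx|nCx] := pselect (C x); first by right.
  by left; split=> //; exact: subset_closure.
have [F20|F20] := pselect (F2 !=set0); last first.
  have FF1 : F = F1.
    by rewrite FE; apply/seteqP; split=> [x [//|F2x]|x]; [case: F20; exists x|left].
  by apply: KW; rewrite // FF1.
have cYF1 : closed (Y `|` F1) by exact: closedU.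
rewrite FE setUA.
apply: (@sel_move_clopen C (Y `|` F1) coC cYF1 K [set b1]) => //.
- by move=> _ ->.
- by move=> x [].
rewrite -setUA; apply: KW.
- exact: closedU.
- by exists b1; right.
- by move=> x [/F1W//|->]; left.
Qed.

End Selections.

(** * Quasi-components in the presence of a selection *)
Section QuasiComponents.
Variable X : topologicalType.

Definition quasi_component (p : X) : set X :=
  [set q | forall H, clopen H -> H p -> H q].

Lemma quasi_component_refl p : quasi_component p p. Proof. by []. Qed.

Lemma quasi_component_sub (p q : X) H :
  clopen H -> quasi_component p q -> H q -> quasi_component p `<=` H.
Proof.
move=> clH Qq Hq; suff Hp : H p by move=> x; apply.
by apply: contrapT => nHp; exact: (Qq (~` H) (clopen_setC clH) nHp).
Qed.

Lemma quasi_componentPn (p w : X) : ~ quasi_component p w ->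
  exists H, [/\ clopen H, quasi_component p `<=` H & ~ H w].
Proof.
move=> /existsNP[H /not_implyP[clH /not_implyP[Hp nHw]]]; exists H; split=> //.
exact: quasi_component_sub Hp.
Qed.

Lemma quasi_component_closed p : closed (quasi_component p).
Proof.
rewrite -openC; apply: open_local => w /quasi_componentPn[H [clH QH nHw]].
exists (~` H); split=> //; first by have [] := clopen_setC clH.
by move=> x nHx /QH.
Qed.

Lemma component_sub_quasi p :
  connected_component [set: X] p `<=` quasi_component p.
Proof.
move=> x [C [Cp _ /connected_closed2P coC] Cx] H [oH cH] Hp.
apply: (coC H (~` H)) => //.
- exact: open_closedC.
- by move=> y _; exact: EM.
- by exists p.
Qed.

Hypothesis hX : hausdorff_space X.
Variable f : set X -> X.
Hypotheses (f_sel : set_selection f) (f_cont : set_continuous f).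
Variable p : X.
Let Q := quasi_component p.

Let c1 (x : X) : closed [set x]. Proof. exact: hausdorff_closed1. Qed.
#[local] Hint Resolve c1 : core.

(** A point [w] outside [Q] is on the same side of all points of [Q], because
the points [x] selected against [w] form a clopen set inside a clopen
neighbourhood of [Q]. *)
Let pair_const w q q' : ~ Q w -> Q q -> Q q' ->
  f ([set w] `|` [set q]) = q -> f ([set w] `|` [set q']) = q'.
Proof.
move=> /quasi_componentPn[H [clH QH nHw]] Qq Qq' fq.
have cl := clopen_fix hX f_sel f_cont clH (c1 (x := w)) (set1_ne w).
suff /(_ q' Qq') [] : Q `<=` [set x | H x /\ f ([set w] `|` [set x]) = x] by [].
apply: (@quasi_component_sub p q) => //; last by split=> //; exact: QH.
apply: cl; suff -> : f [set w] = w by [].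
exact: (f_sel (c1 (x := w)) (set1_ne w)).
Qed.

Let pair2 (x y : X) : f ([set x] `|` [set y]) = x \/ f ([set x] `|` [set y]) = y.
Proof. exact: (f_sel (closedU (c1 (x := x)) (c1 (x := y))) (setU1_ne _ _)). Qed.

(** So the complement of [Q] splits into two open sets, of the points that lose
and of those that win against [Q]. A point of [Q] in the closure of one of them
is extreme in [Q], hence unique. *)
Let up := [set w | ~ Q w /\ f ([set w] `|` [set p]) = p].
Let dn := [set w | ~ Q w /\ f ([set w] `|` [set p]) = w].

Let upP w q : up w -> Q q -> f ([set w] `|` [set q]) = q.
Proof. by move=> [nQw fw] Qq; apply: (@pair_const w p). Qed.

Let dnP w q : dn w -> Q q -> f ([set w] `|` [set q]) = w.
Proof.
move=> [nQw fw] Qq; have [//|fq] := pair2 w q.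
have fp := @pair_const w q p nQw Qq (@quasi_component_refl p) fq.
by case: nQw; rewrite -fw fp; exact: quasi_component_refl.
Qed.

Let updn w : ~ Q w -> up w \/ dn w.
Proof. by move=> nQw; have [|] := pair2 w p; [right|left]. Qed.

Let split_near w : ~ Q w -> exists H, [/\ clopen H, H w, H `<=` ~` Q &
  clopen [set x | H x /\ f ([set p] `|` [set x]) = x]].
Proof.
move=> /quasi_componentPn[H [clH QH nHw]].
have clH' := clopen_setC clH; exists (~` H); split=> //.
  by move=> x nHx /QH.
apply: clopen_fix => //; suff -> : f [set p] = p by apply; exact: QH.
exact: (f_sel (c1 (x := p)) (set1_ne p)).
Qed.

Let open_dn : open dn.
Proof.
apply: open_local => w [nQw fw].
have [H [clH Hw HQ [oG _]]] := split_near nQw.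
exists [set x | H x /\ f ([set p] `|` [set x]) = x]; split=> //=.
  by rewrite setUC.
by move=> x /= [Hx fx]; split; [exact: HQ|rewrite setUC].
Qed.

Let open_up : open up.
Proof.
apply: open_local => w [nQw fw].
have [H [clH Hw HQ [_ cG]]] := split_near nQw.
exists (H `&` ~` [set x | H x /\ f ([set p] `|` [set x]) = x]); split=> //=.
- by apply: openI; [case: clH|exact: closed_openC].
- split=> // -[_]; rewrite setUC fw => pw; apply: nQw; rewrite -pw.
  exact: quasi_component_refl.
- move=> x /= [Hx fx]; split; first exact: HQ.
  by have [fxx|//] := pair2 x p; case: fx; split; rewrite // setUC.
Qed.

Let cl_up c q : closure up c -> Q q -> f ([set c] `|` [set q]) = q.
Proof.
move=> clc Qq; rewrite setUC.
suff : closure up `<=` [set x | [set q] (f ([set q] `|` [set x]))] by apply.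
have cK : closed [set x | [set q] (f ([set q] `|` [set x]))].
  exact: closed_sel1.
rewrite [X in _ `<=` X](closure_id _).1//; apply: closureS => x upx /=.
by rewrite setUC; exact: upP.
Qed.

Let cl_dn c q : closure dn c -> Q q -> f ([set c] `|` [set q]) = c.
Proof.
move=> clc Qq; rewrite setUC.
suff : closure dn `<=` [set x | f ([set q] `|` [set x]) = x] by apply.
have cK : closed [set x | f ([set q] `|` [set x]) = x].
  exact: closed_fix.
rewrite [X in _ `<=` X](closure_id _).1//; apply: closureS => x upx /=.
by rewrite setUC; exact: dnP.
Qed.

Let bd_up : exists2 b, Q b & forall x, Q x -> closure up x -> x = b.
Proof.
have [[b [Qb clb]]|nb] := pselect (exists b, Q b /\ closure up b).
  exists b => // x Qx clx.
  by rewrite -[RHS](cl_up clx Qb) setUC (cl_up clb Qx).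
by exists p; [exact: quasi_component_refl|move=> x Qx clx; case: nb; exists x].
Qed.

Let bd_dn : exists2 b, Q b & forall x, Q x -> closure dn x -> x = b.
Proof.
have [[b [Qb clb]]|nb] := pselect (exists b, Q b /\ closure dn b).
  exists b => // x Qx clx.
  by rewrite -[LHS](cl_dn clx Qb) setUC (cl_dn clb Qx).
by exists p; [exact: quasi_component_refl|move=> x Qx clx; case: nb; exists x].
Qed.

Lemma quasi_component_boundary : exists b1 b2, [/\ Q b1, Q b2 &
  forall x, Q x -> closure (~` Q) x -> x = b1 \/ x = b2].
Proof.
have [b1 Qb1 Hb1] := bd_up; have [b2 Qb2 Hb2] := bd_dn.
exists b1, b2; split=> // x Qx.
suff /closureS/(_ x) H : ~` Q `<=` up `|` dn.
  by move/H; rewrite closureU => -[/(Hb1 _ Qx)|/(Hb2 _ Qx)]; [left|right].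
by move=> w /updn.
Qed.

(** A splitting of [Q] into two closed parts extends to [X]: give each of the
two open pieces of the complement to the part that contains its only limit point
in [Q]. A clopen set containing [p] but not all of [Q] results. *)
Lemma quasi_component_connected : connected Q.
Proof.
apply/connected_closed2P => K1 K2 cK1 cK2 QK dK [x [Qx K1x]] q Qq.
have [b1 Qb1 Hb1] := bd_up; have [b2 Qb2 Hb2] := bd_dn.
apply: contrapT => nK1q; have K2q : K2 q by case: (QK _ Qq).
pose T K := (Q `&` K) `|` ((closure up `&` [set y | K b1]) `|`
                           (closure dn `&` [set y | K b2])).
have ccst (P : Prop) : closed [set y : X | P].
  have [HP|nP] := pselect P.
    have -> : [set _ : X | P] = setT by apply/seteqP; split.
    exact: closedT.
  have -> : [set _ : X | P] = set0 by apply/seteqP; split.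
  exact: closed0.
have cT K : closed K -> closed (T K).
  move=> cK; apply: closedU; first by apply: closedI => //;
    exact: quasi_component_closed.
  by apply: closedU; apply: closedI => //; exact: closed_closure.
have TT y : T K1 y \/ T K2 y.
  have [Qy|/updn[upy|dny]] := pselect (Q y).
  - by have [K1y|K2y] := QK _ Qy; [left|right]; left.
  - have [K1b|K2b] := QK _ Qb1; [left|right]; right; left;
      by split=> //; exact: subset_closure.
  - have [K1b|K2b] := QK _ Qb2; [left|right]; right; right;
      by split=> //; exact: subset_closure.
have dud y : up y -> closure dn y -> False.
  move=> upy cly; have [z [[_ dz] [nQz uz]]] := closure_meet cly open_up upy.
  by apply: nQz; rewrite -dz uz.
have ddu y : dn y -> closure up y -> False.
  move=> upy cly; have [z [[_ dz] [nQz uz]]] := closure_meet cly open_dn upy.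
  by apply: nQz; rewrite -uz dz.
have TK K y : T K y -> Q y -> K y.
  by move=> [[]//|[[cl /= Kb]|[cl /= Kb]]] Qy; [rewrite (Hb1 y)|rewrite (Hb2 y)].
have Tup K y : T K y -> up y -> K b1.
  by move=> [[Qy _]|[[]//|[cl _]]] upy; [case: upy|case: (dud y)].
have Tdn K y : T K y -> dn y -> K b2.
  by move=> [[Qy _]|[[cl _]|[]//]] dny; [case: dny|case: (ddu y)].
have TTn y : T K1 y -> T K2 y -> False.
  move=> T1 T2; have [Qy|/updn[upy|dny]] := pselect (Q y).
  - by apply: (dK y) => //; exact: TK.
  - by apply: (dK b1) => //; apply: (Tup _ y).
  - by apply: (dK b2) => //; apply: (Tdn _ y).
have clT : clopen (T K1).
  split; last exact: cT.
  rewrite (_ : T K1 = ~` T K2); first exact/closed_openC/cT.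
  apply/seteqP; split=> y; first by move=> T1 T2; exact: (TTn y).
  by have [] := TT y.
apply: nK1q; apply: TK => //.
by apply: (quasi_component_sub clT Qx) => //; left.
Qed.

Lemma quasi_componentE : Q = connected_component [set: X] p.
Proof.
apply/seteqP; split; last exact: component_sub_quasi.
apply: connected_component_max => //.
exact: quasi_component_connected.
Qed.

End QuasiComponents.

(** * Producing countable approaches *)
Lemma countably_approachable_seq (X : topologicalType) (p : X) (G : nat -> set X) :
  hausdorff_space X -> (forall k, clopen (G k)) -> (forall k, G k !=set0) ->
  (forall k, ~ G k p) ->
  (forall O, open O -> O p -> exists N, forall k, (N <= k)%N -> G k `<=` O) ->
  countably_approachable p.
Proof.
move=> hX clG G0 nGp Gp; right.
pose U := \bigcup_k G k.
have clopenN N : clopen (\bigcup_(k in `I_N) G k).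
  elim: N => [|N [oN cN]].
    by rewrite II0 bigcup_set0; exact: clopen0.
  rewrite IIS bigcup_setU bigcup_set1; have [oG cG] := clG N.
  by split; [exact: openU|exact: closedU].
have clU : closure U = U `|` [set p].
  apply/seteqP; split=> y.
    move=> clUy; have [->|/(hausdorff_sep hX)] := pselect (y = p); first by right.
    move=> [O [O' [oO oO' Oy O'p OO']]]; left.
    have [N HN] := Gp O' oO' O'p.
    have [_ cN] := clopenN N.
    have [//|nNy] := pselect ((\bigcup_(k in `I_N) G k) y).
      by move=> [k _ Gky]; exists k.
    have oON : open (O `&` ~` \bigcup_(k in `I_N) G k).
      by apply: openI => //; exact: closed_openC.
    have [z [[k _ Gkz] [Oz nNz]]] := closure_meet clUy oON (conj Oy nNy).
    exfalso; have [kN|Nk] := ltnP k N; first by apply: nNz; exists k.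
    by apply: (OO' z) => //; exact: (HN k).
  move=> [/subset_closure//|->] B; rewrite nbhsE => -[O [oO Op] OB].
  have [N HN] := Gp O oO Op; have [x Gx] := G0 N.
  by exists x; split; [exists N|apply: OB; exact: (HN N)].
exists U; split=> //.
- by apply: bigcup_open => k _; case: (clG k).
- by move=> x [k _ Gkx] xp; apply: (nGp k); rewrite -xp.
have pU : p \in closure U by rewrite clU inE; right.
exists (exist _ p pU) => //.
pose W N : set (closure U) := set_val @^-1` (~` \bigcup_(k in `I_N) G k).
exists (range W); split.
- have /card_le_trans := @card_image_le _ _ W setT; apply; exact: countableP.
- move=> _ [N _ <-]; split; last by move=> [k _]; exact: nGp.
  apply: preimage_clopen; first exact: clopen_setC (clopenN N).
  exact: initial_continuous.
move=> V; rewrite nbhsE => -[_ [[O oO <-] Op] OV].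
have [N HN] := Gp O oO Op.
exists (W N); first by exists N.
move=> x nNx; apply: OV => /=.
have Ux : (U `|` [set p]) (set_val x) by rewrite -clU; move: (valP x); rewrite inE.
case: Ux => [[k _ Gkx]|->//].
have [kN|Nk] := ltnP k N; first by case: nNx; exists k.
exact: (HN k).
Qed.


Section Approaching.
Variable X : topologicalType.
Hypothesis hX : hausdorff_space X.
Variable f : set X -> X.
Hypotheses (f_sel : set_selection f) (f_cont : set_continuous f).

Let c1 (x : X) : closed [set x]. Proof. exact: hausdorff_closed1. Qed.
#[local] Hint Resolve c1 : core.

(** Removing selected points one by one from the finite part in [R], the value
eventually leaves [R]; the last point removed is then a fixed point of [x |-> f
(D U {x})] while [f D] is outside [R], as [clopen_fix] requires. *)
Lemma sel_isolate R Z (s : seq X) : closed Z -> Z !=set0 -> Z `&` R = set0 ->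
  [set` s] `<=` R -> R (f (Z `|` [set` s])) ->
  exists D, [/\ closed D, Z `<=` D, ~ R (f D) &
    exists x, R x /\ f (D `|` [set x]) = x].
Proof.
move=> cZ Z0 ZR; have [n] := ubnP (size s); elim: n s => // n IH s sn sR Rf.
set t := f _ in Rf.
have [Zt|ts] : (Z `|` [set` s]) t.
  apply: f_sel; first by apply: closedU => //; exact: closed_seq.
  by have [z Zz] := Z0; exists z; left.
  by have : (Z `&` R) t by []; rewrite ZR.
pose s' := [seq x <- s | x != t].
have s'E : Z `|` [set` s] = Z `|` [set` s'] `|` [set t].
  rewrite -setUA; congr setU; apply/seteqP; split=> x /=.
    move=> xs; have [->|xt] := eqVneq x t; first by right.
    by left; rewrite mem_filter xt.
  by move=> [|->//]; rewrite mem_filter => /andP[].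
have s'R : [set` s'] `<=` R by move=> x /=; rewrite mem_filter => /andP[_ /sR].
have [Rf'|nRf'] := pselect (R (f (Z `|` [set` s']))).
  apply: (IH s') => //; apply: (@leq_trans (size s)) => //.
  rewrite size_filter -(count_predC (pred1 t) s) -[ltnLHS]add0n ltn_add2r.
  by rewrite -has_count has_pred1.
have cs' : closed (Z `|` [set` s']) by apply: closedU => //; exact: closed_seq.
exists (Z `|` [set` s']); split=> //.
by exists t; split=> //; rewrite -s'E.
Qed.

(** The only way in which countable approachability is ever obtained. The rings
[R k] are disjoint, so every point lies outside all but one of them and the sets
[Z k = Y (phi k.+1) \ R k] still converge to [X]: whatever is selected from sets
containing [Z k] tends to [p], in particular the clopen sets of fixed points. *)
Lemma sel_limit_approachable p (K Y : nat -> set X) :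
  (forall n, clopen (K n)) -> (forall n, K n p) ->
  (forall n, K n.+1 `<=` K n) -> (forall n, closed (Y n)) ->
  (forall n, Y n p) -> (forall n, ~` K n `<=` Y n) ->
  (forall x, exists N, forall n, (N <= n)%N -> Y n x) ->
  (forall n, ~ K n (f (Y n))) -> f setT = p -> countably_approachable p.
Proof.
move=> clK Kp Kdec cY Yp KY Ylim nKf fT.
have Yn n : Y n !=set0 by exists p.
have decr m n : (m <= n)%N -> K n `<=` K m.
  move=> /subnK <-; elim: (n - m)%N => [//|k IH]; rewrite addSn.
  by move=> x /Kdec/IH.
have fY O : open O -> O p -> vnear setT (fun B => O (f B)).
  move=> oO Op; apply: f_cont => //; first by exists p.
  by rewrite fT.
have [m|g Hg] := @choice nat nat (fun m n => (m < n)%N /\ K m (f (Y n))).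
  have [oK _] := clK m.
  have [G [Vs [_ GT VsT HB]]] := fY _ oK (Kp m).
  suff [N HN] : exists N, forall n, (N <= n)%N -> forall V, V \in Vs -> Y n `&` V
    !=set0.
    exists (maxn N m.+1); split; first by rewrite leq_maxr.
    apply: HB => //; first by move=> x _; exact: GT.
    by apply: HN; rewrite leq_maxl.
  elim: Vs VsT {HB} => [|V Vs IH] VsT; first by exists 0%N.
  have [|N HN] := IH; first by move=> W WVs; apply: VsT; rewrite inE WVs orbT.
  have [_ [x [_ Vx]]] := VsT V (mem_head _ _).
  have [N' HN'] := Ylim x; exists (maxn N N') => n;
    rewrite geq_max => /andP[Nn N'n].
  move=> W; rewrite inE => /orP[/eqP ->|]; last exact: HN.
  by exists x; split=> //; exact: HN'.
(* A subsequence along which each value lies in the preceding clopen set. *)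
pose phi k := iter k g 0%N.
have phiS k : (phi k < phi k.+1)%N by have [] := Hg (phi k).
have phi_ge k : (k <= phi k)%N by elim: k => // k IH;
  exact: leq_ltn_trans IH (phiS k).
have phi_mono k l : (k <= l)%N -> (phi k <= phi l)%N.
  move=> /subnK <-; elim: (l - k)%N => [//|j IH]; rewrite addSn.
  exact: leq_trans (ltnW (phiS _)).
pose R k := K (phi k) `\` K (phi k.+1).
have clR k : clopen (R k).
  by rewrite /R setDE; apply: clopenI => //; exact: clopen_setC.
have RY k : R k `<=` Y (phi k.+1) by move=> x [_ /KY].
have Rdisj k l x : R k x -> R l x -> k = l.
  wlog kl : k l / (k <= l)%N.
    by move=> H Rk Rl; have [/H|/ltnW/H->] := leqP k l; [apply|..].
  move=> [_ nKx] [Kx _]; apply/eqP; rewrite eqn_leq kl /= leqNgt.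
  by apply/negP => kl'; apply: nKx; apply: decr Kx; exact: phi_mono.
pose Z k := Y (phi k.+1) `\` R k.
have cZ k : closed (Z k).
  rewrite /Z setDE; apply: closedI => //; apply: open_closedC.
  by case: (clR k).
have Zp k : Z k p by split=> // -[].
have YE k : Y (phi k.+1) = Z k `|` R k.
  apply/seteqP; split=> [x Yx|x [[]//|/RY//]].
  by have [|] := pselect (R k x); [right|left].
have HD k : exists D, [/\ closed D, Z k `<=` D, ~ R k (f D) &
    exists x, R k x /\ f (D `|` [set x]) = x].
  have Rf : R k (f (Z k `|` R k)).
    by rewrite -YE; split; [have [] := Hg (phi k)|exact: nKf].
  have [oR cR] := clR k.
  have Rn : R k !=set0 by exists (f (Z k `|` R k)).
  have [|s [s0 sR Rs]] :=
      @vnear_finite _ (Z k) (R k) (R k) (fun B => R k (f B)) (cZ k) hX Rn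
        (@subset_refl _ _) (@subset_closure _ _).
    by apply: f_cont => //; [exact: closedU|exists p; left].
  apply: (@sel_isolate (R k) (Z k) s) => //; first by exists p.
  by apply/seteqP; split=> // x [[]].
have [D /all_and4[cD ZD nRD GD]] := choice HD.
have DE k := clopen_fix hX f_sel f_cont (clR k) (cD k) _ (nRD k).
apply: (@countably_approachable_seq _ _
  (fun k => [set x | R k x /\ f (D k `|` [set x]) = x])) => //.
- by move=> k; apply: DE; exists p; exact: ZD.
- by move=> k [[_]].
move=> O oO Op; have [G [Vs [_ GT VsT HB]]] := fY _ oO Op.
suff [N HN] : exists N, forall k, (N <= k)%N -> forall V, V \in Vs -> D k `&` V
  !=set0.
  exists N => k Nk x [_ <-]; apply: HB.
  - exact: closedU.
  - exact: setU1_ne.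
  - by move=> y _; exact: GT.
  - by move=> V /(HN _ Nk)[y [Dy Vy]]; exists y; split=> //; left.
elim: Vs VsT {HB} => [|V Vs IH] VsT; first by exists 0%N.
have [|N HN] := IH; first by move=> W WVs; apply: VsT; rewrite inE WVs orbT.
have [_ [x [_ Vx]]] := VsT V (mem_head _ _).
suff [N' HN'] : exists N', forall k, (N' <= k)%N -> D k x.
  exists (maxn N N') => k; rewrite geq_max => /andP[Nk N'k] W.
  rewrite inE => /orP[/eqP ->|]; last exact: HN.
  by exists x; split=> //; exact: HN'.
have [N1 HN1] := Ylim x.
have [[l Rl]|nR] := pselect (exists l, R l x); last first.
  exists N1 => k N1k; apply: ZD; split; last by move=> Rk; apply: nR; exists k.
  by apply: HN1; apply: leq_trans N1k _; apply: leq_trans (phi_ge _) _;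
    exact: phi_mono.
exists (maxn N1 l.+1) => k; rewrite geq_max => /andP[N1k lk]; apply: ZD; split.
  by apply: HN1; apply: leq_trans N1k _; apply: leq_trans (phi_ge _) _;
    exact: phi_mono.
by move=> Rk; move: lk; rewrite (Rdisj _ _ _ Rl Rk) ltnn.
Qed.

End Approaching.

(** * A clopen base of the component *)
Section ClopenBase.
Variable X : topologicalType.
Hypothesis hX : hausdorff_space X.
Variable f : set X -> X.

(** Closed subsets of [H] win against the complement of [E]. The closure makes
the notion pass to intersections of families of sets [E]. *)
Definition prevails E H := forall F, closed F -> F !=set0 -> F `<=` H ->
  F (f (closure (~` E) `|` F)).

Hypotheses (f_sel : set_selection f) (f_cont : set_continuous f).
Variable p : X.
Hypothesis fT : f setT = p.
Hypothesis nOmega : ~ countably_approachable p.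

Let c1 (x : X) : closed [set x]. Proof. exact: hausdorff_closed1. Qed.
#[local] Hint Resolve c1 : core.

(** [sel_limit_approachable] in inductive form, with [Z U F] as the closed sets:
a step must select outside [K] as long as [F] avoids a set [M] that the next
step swallows. Finite sets of points that are never swallowed are legitimate
sets [F] at all steps; the closure of the set of all these points, added to the
sets [Z], completes them to a sequence converging to [X]. *)
Lemma no_approach_scheme (I : set X -> set X -> set X -> Prop) :
  (forall K Z M, I K Z M -> [/\ clopen K, closed Z, ~` K `<=` Z & K p /\ ~ M p] /\
    forall F, closed F -> F !=set0 -> F `<=` ~` M -> ~ K (f (Z `|` F))) ->
  (forall K Z M, I K Z M ->
    exists K' Z' M', [/\ I K' Z' M', K' `<=` K, M `<=` M' & M `<=` Z']) ->
  ~ exists K Z M, I K Z M.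
Proof.
move=> HI Hstep [K0 [Z0 [M0 I0]]]; apply: nOmega.
pose T := {t : set X * set X * set X | I t.1.1 t.1.2 t.2}.
pose t0 : T := exist (fun t => I t.1.1 t.1.2 t.2) (K0, Z0, M0) I0.
have [t|g Hg] := @choice T T (fun t t' =>
    [/\ (sval t').1.1 `<=` (sval t).1.1, (sval t).2 `<=` (sval t').2 &
        (sval t).2 `<=` (sval t').1.2]).
  have [K' [Z' [M' [I' KK MM MZ]]]] := Hstep _ _ _ (svalP t).
  by exists (exist (fun t => I t.1.1 t.1.2 t.2) (K', Z', M') I').
pose K n := (sval (iter n g t0)).1.1; pose Z n := (sval (iter n g t0)).1.2.
pose M n := (sval (iter n g t0)).2.
have I_ n : I (K n) (Z n) (M n) by exact: svalP (iter n g t0).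
have [clK cZ KZ KM] : [/\ forall n, clopen (K n), forall n, closed (Z n),
    forall n, ~` K n `<=` Z n & forall n, K n p /\ ~ M n p].
  by split=> n; have [[]] := HI _ _ _ (I_ n).
have st n : [/\ K n.+1 `<=` K n, M n `<=` M n.+1 & M n `<=` Z n.+1].
  exact: Hg (iter n g t0).
have Mmono m n : (m <= n)%N -> M m `<=` M n.
  move=> /subnK <-; elim: (n - m)%N => [//|k IH]; rewrite addSn => x /IH.
  by have [_ + _] := st (k + m)%N; apply.
pose L0 := \bigcap_n ~` M n.
have L0p : L0 p by move=> n _; have [] := KM n.
apply: (@sel_limit_approachable _ hX _ f_sel f_cont p K (fun n =>
  Z n `|` closure L0)) => //.
- by move=> n; have [] := KM n.
- by move=> n; have [] := st n.
- by move=> n; apply: closedU => //; exact: closed_closure.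
- by move=> n; right; exact: subset_closure.
- by move=> n x /KZ; left.
- move=> x; have [L0x|] := pselect (L0 x).
    by exists 0%N => n _; right; exact: subset_closure.
  move=> /existsNP[m /not_implyP[_ /contrapT Mx]]; exists m.+1 => -[//|n] mn.
  by left; have [_ _] := st n; apply; apply: Mmono Mx.
- move=> n; have [oK _] := clK n; have [_ HF] := HI _ _ _ (I_ n).
  apply: (@sel_dense _ hX _ f_cont (Z n) (closure L0) L0 (~` K n)) => //.
  + exact: closed_closure.
  + exact: open_closedC.
  + by exists p.
  + exact: subset_closure.
  + move=> s s0 sL; apply: HF => //; first exact: closed_seq.
    by move=> x /sL /(_ n); apply.
Qed.

Let C := quasi_component p.
Let Cp : C p. Proof. exact: quasi_component_refl. Qed.
Let cC : closed C. Proof. exact: quasi_component_closed. Qed.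
Let coC : connected C. Proof. exact: (quasi_component_connected hX f_sel f_cont).
  Qed.
Let C0 : C !=set0. Proof. by exists p. Qed.
Let p1C : [set p] `<=` C. Proof. by move=> _ ->. Qed.
Let CH H : clopen H -> H p -> C `<=` H. Proof. by move=> clH Hp x; apply. Qed.

Lemma component_near Y K : closed Y -> clopen K -> K (f (Y `|` [set p])) ->
  exists W, [/\ open W, C `<=` W &
    forall F, closed F -> F !=set0 -> F `<=` W -> K (f (Y `|` F))].
Proof.
have [b1 [b2 [Cb1 Cb2 Hb]]] := quasi_component_boundary hX f_sel f_cont p.
by move=> cY clK Kp; apply: (sel_near hX f_cont coC cY cC Cb1 Cb2 Hb clK Cp).
Qed.

(** If [C] wins against [M], then [C] lies in the clopen set of the points that
win individually, cut off from the point [f M], and this set misses [M]. *)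
Lemma component_clopen_sep M : closed M -> (forall x, M x -> ~ C x) ->
  C (f (M `|` C)) -> exists H, [/\ clopen H, H p & forall x, H x -> ~ M x].
Proof.
move=> cM MC Cf; have [M0|nM0] := pselect (M !=set0); last first.
  by exists setT; split=> //; [exact: clopenT|move=> x _ Mx; apply: nM0; exists x].
have [R [clR CR nRm]] := quasi_componentPn (MC _ (f_sel cM M0)).
exists [set x | R x /\ f (M `|` [set x]) = x]; split.
- exact: clopen_fix.
- split; first exact: CR.
  have Cfp : C (f (M `|` [set p])).
    apply: (sel_move hX f_cont coC cM cC cM _ _ cC C0 _ _ _ _ Cf) => //.
    + by move=> x Cx /MC.
    + move=> F cF F0 FC; have [|/FC] : (M `|` F) (f (M `|` F)); last by left.
      * by apply: f_sel; [exact: closedU|have [x Fx] := F0; exists x; right].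
      * by right.
  by have [/MC|] := f_sel (closedU cM (c1 (x := p))) (setU1_ne M p).
- move=> x [Rx fx] Mx; apply: nRm; suff -> : f M = x by [].
  rewrite -[RHS]fx; congr f; apply/seteqP; split=> y; first by left.
  by case=> // ->.
Qed.

(** If [U] contains no clopen neighbourhood of [C], then by
[component_clopen_sep] [C] never wins against a closed set [M] containing [~ U].
Add to [M] the complement of a small clopen [H]: the value is close to [p],
hence outside [M], so it lies outside [H]. By [sel_near] this persists on a
neighbourhood of [C], whose complement is added to [M], and the process repeats.
*)
Lemma clopen_base_component U : open U -> C `<=` U ->
  exists H, [/\ clopen H, H p & H `<=` U].
Proof.
move=> oU CU; apply: contrapT => nH.
pose I K Z M := [/\ clopen K, K p, closed Z & ~` K `<=` Z] /\
  [/\ closed M, forall x, M x -> ~ C x, ~` U `<=` M &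
    forall F, closed F -> F !=set0 -> F `<=` ~` M -> ~ K (f (Z `|` F))].
have step K M : clopen K -> K p -> closed M -> (forall x, M x -> ~ C x) ->
    ~` U `<=` M ->
    exists K' Z' M', [/\ I K' Z' M', K' `<=` K, M `<=` M' & M `<=` Z'].
  move=> clK Kp cM MC UM.
  pose D := [set (~` H `|` M) `|` C | H in [set H | [/\ clopen H, H p & H `<=` K]]].
  have [||||_ [H [clH Hp HK] <-] HM] :=
      @vnear_limit _ D setT (fun B => ~ M (f B)).
  - by exists (~` K `|` M `|` C); exists K => //; split=> //; exact: subset_refl.
  - move=> _ _ [H1 [cl1 H1p H1K] <-] [H2 [cl2 H2p H2K] <-].
    exists ((~` (H1 `&` H2) `|` M) `|` C).
      exists (H1 `&` H2) => //; split=> //; first exact: clopenI.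
      by move=> x [/H1K].
    move=> x [[[nHx|Mx]|Cx]|[[nHx|Mx]|Cx]]; try (by right); try (by left; right).
      by left; left=> -[].
    by left; left=> -[].
  - move=> x _; apply: subset_closure; have [Cx|/quasi_componentPn[H [clH CsH
      nHx]]] := pselect (C x).
      exists ((~` K `|` M) `|` C); last by right.
      by exists K => //; split=> //; exact: subset_refl.
    exists ((~` (H `&` K) `|` M) `|` C); last by left; left=> -[].
    by exists (H `&` K) => //; split; [exact: clopenI|split=> //;
      exact: CsH|move=> y []].
  - apply: (@f_cont setT (~` M)).
    + exact: closedT.
    + by exists p.
    + exact: closed_openC.
    + by rewrite fT => /MC.
  have cHM : closed (~` H `|` M).
    by apply: closedU => //; case: (clopen_setC clH).
  have cHMC : closed (~` H `|` M `|` C) by exact: closedU.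
  have HMC0 : ~` H `|` M `|` C !=set0 by exists p; right.
  have nM := HM _ cHMC HMC0 (@subset_refl _ _) (@subsetT _ _).
  have nHf : (~` H) (f (~` H `|` M `|` C)).
    have [[//|//]|Cf] := f_sel cHMC HMC0.
    have [|H0 [clH0 H0p H0M]] := component_clopen_sep cHM _ Cf.
      by move=> x [nHx /(CH clH Hp)|/MC].
    case: nH; exists H0; split=> // x /H0M nx; apply: contrapT => nUx.
    by apply: nx; right; exact: UM.
  have [|W [oW CW WF]] := component_near cHM (clopen_setC clH) _.
    exact: (sel_move_clopen hX f_cont coC cHM (clopen_setC clH) cC C0 _ _ _ _ nHf).
  exists H, (~` H `|` M), (M `|` ~` W); split=> //.
  split; first by split.
  split.
  - by apply: closedU => //; exact: open_closedC.
  - by move=> x [/MC//|nWx /CW].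
  - by move=> x /UM; left.
  - move=> F cF F0 FM; apply: WF => // x /FM nMW; apply: contrapT => nW.
    by apply: nMW; right.
apply: (@no_approach_scheme I).
- by move=> K Z M [[clK Kp cZ KZ] [cM MC UM HF]]; split=> //; split=> //;
    split=> // /MC.
- by move=> K Z M [[clK Kp cZ KZ] [cM MC UM HF]]; exact: step.
have [|||||K [Z [M []]]] := step setT (~` U); last by exists K, Z, M.
- exact: clopenT.
- by [].
- exact: open_closedC.
- by move=> x nUx /CU.
- by [].
Qed.

(** By [sel_move] it is the same to ask that every nonempty closed subset of [C]
wins against the complement of [H]. *)
Definition tame H := [/\ clopen H, H p & H (f (~` H `|` [set p]))].

Lemma tame_sel H F : tame H -> closed F -> F !=set0 -> F `<=` C ->
  F (f (~` H `|` F)).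
Proof.
move=> [clH Hp Hf] cF F0 FC.
have cH : closed (~` H) by case: (clopen_setC clH).
have : H (f (~` H `|` F)).
  exact: (sel_move_clopen hX f_cont coC cH clH _ _ _ _ _ _ Hf).
have [//|//] : (~` H `|` F) (f (~` H `|` F)).
apply: f_sel; first exact: closedU.
by have [x Fx] := F0; exists x; right.
Qed.

(** If no small clopen set is tame, then the value is always outside [H], on a
neighbourhood of [C] in which the next [H] is chosen. *)
Lemma tame_base U : open U -> C `<=` U -> exists H, tame H /\ H `<=` U.
Proof.
move=> oU CU; apply: contrapT => nH.
pose I K Z M := exists H, [/\ [/\ clopen K, K p & K `<=` U],
  [/\ clopen H, H p & H `<=` K], Z = ~` K, M = ~` H &
  forall F, closed F -> F !=set0 -> F `<=` H -> ~ K (f (~` K `|` F))].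
have step K : clopen K -> K p -> K `<=` U -> exists M, I K (~` K) M.
  move=> clK Kp KU; have cK := (clopen_setC clK).2.
  have nK : ~ K (f (~` K `|` [set p])).
    by move=> Kf; apply: nH; exists K.
  have [W [oW CW WF]] := component_near cK (clopen_setC clK) nK.
  have [||H [clH Hp HW]] := @clopen_base_component (W `&` K).
  - by apply: openI => //; case: clK.
  - by move=> x Cx; split; [exact: CW|exact: CH Cx].
  exists (~` H), H; split=> //; first by split=> // x /HW[].
  by move=> F cF F0 FH; apply: WF => // x /FH/HW[].
apply: (@no_approach_scheme I).
- move=> K Z M [H [[clK Kp KU] [clH Hp HK] -> -> HF]]; split.
    by split=> //; [case: (clopen_setC clK)|split].
  by move=> F cF F0; rewrite setCK; exact: HF.
- move=> K Z M [H [[clK Kp KU] [clH Hp HK] _ -> HF]].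
  have [|M' IM'] := step H clH Hp; first by move=> x /HK/KU.
  exists H, (~` H), M'; split=> //.
  by have [H' [_ [_ _ H'H] _ -> _]] := IM'; exact: subsetC.
have [H [clH Hp HU]] := clopen_base_component oU CU.
by have [M IM] := step H clH Hp HU; exists H, (~` H), M.
Qed.

Lemma sel_bigcap (E_ : set (set X)) F : E_ !=set0 ->
  (forall A B, E_ A -> E_ B -> exists2 G, E_ G & G `<=` A `&` B) ->
  closed F -> F !=set0 ->
  (forall E, E_ E -> F (f (closure (~` E) `|` F))) ->
  F (f (closure (~` \bigcap_(E in E_) E) `|` F)).
Proof.
move=> [E0 EE0] dirE cF F0 HF; apply: contrapT => nF.
pose D := [set closure (~` E) `|` F | E in E_].
have ccl A : closed (closure A `|` F) by apply: closedU => //;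
  exact: closed_closure.
have ne A : closure A `|` F !=set0 by have [x Fx] := F0; exists x; right.
have [||||_ [E EE <-] HP] := @vnear_limit _ D
    (closure (~` \bigcap_(E in E_) E) `|` F) (fun B => ~ F (f B)).
- by exists (closure (~` E0) `|` F), E0.
- move=> _ _ [A EA <-] [B EB <-]; have [G EG GAB] := dirE _ _ EA EB.
  exists (closure (~` G) `|` F); first by exists G.
  have GA : closure (~` A) `<=` closure (~` G).
    by apply: closureS => x nAx /GAB[].
  have GB : closure (~` B) `<=` closure (~` G).
    by apply: closureS => x nAx /GAB[].
  by move=> x [[/GA|]|[/GB|]]; [left|right|left|right].
- rewrite setC_bigcap => x [|Fx].
    apply: closureS => y [E EE nEy]; exists (closure (~` E) `|` F);
      first by exists E.
    by left; exact: subset_closure.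
  by apply: subset_closure; exists (closure (~` E0) `|` F); [exists E0|right].
- by apply: (@f_cont _ (~` F)) => //; exact: closed_openC.
apply: (HP (closure (~` E) `|` F)) => //; last exact: HF.
apply: setSU; apply: closureS; apply: subsetC => x; exact.
Qed.

Lemma bigcap_tame : \bigcap_(H in tame) H = C.
Proof.
apply/seteqP; split=> [x Hx|x Cx H [clH Hp _]]; last exact: (CH clH Hp).
apply: contrapT => /quasi_componentPn[H [[oH _] CsH nHx]].
have [H' [tH' HH]] := tame_base oH CsH; apply: nHx; apply: HH; exact: Hx tH'.
Qed.

Lemma component_prevails : prevails C C.
Proof.
move=> F cF F0 FC; rewrite -bigcap_tame; apply: sel_bigcap => //.
- by have [H [tH _]] := tame_base openT (@subsetT _ C); exists H.
- move=> A B [[oA cA] Ap Af] [[oB cB] Bp Bf].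
  have [||H [tH HAB]] := @tame_base (A `&` B); [exact: openI| |by exists H].
  by move=> x Cx; split; [exact: (CH (conj oA cA) Ap)|exact: (CH (conj oB cB) Bp)].
- move=> H tH; have := tame_sel tH cF F0 FC; have [[oH _] _ _] := tH.
  by rewrite -(closure_id (~` H)).1 //; exact: open_closedC.
Qed.

(** Hence a set that prevails over its own complement has at most one boundary
point. *)
Lemma prevails_boundary L x : prevails L L ->
  L x -> closure (~` L) x -> f (closure (~` L)) = x.
Proof.
move=> goodL Lx clx.
have : [set x] (f (closure (~` L) `|` [set x])) by apply: goodL => // _ ->.
suff -> : closure (~` L) `|` [set x] = closure (~` L) by [].
by apply/seteqP; split=> y; [case=> // ->|left].
Qed.

Lemma component_boundary c : C c -> closure (~` C) c -> f (closure (~` C)) = c.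
Proof. exact: (prevails_boundary component_prevails). Qed.

(** If [L \ C] were not closed, then [z], being the only boundary point of [C],
would be a limit of [L \ C] as well as of the complement of [L]. The sets [L \
H], with [H] a clopen neighbourhood of [C], win against [C] and tend to [L \ C];
as [f X = p] this forces [z = p]. But then [L \ H] also wins against [p]
together with the part of [closure (~ L)] outside a smaller clopen set;
iterating, the value stays outside clopen neighbourhoods of [p] along a sequence
converging to [X]. *)
Lemma prevails_diff_closed L z : closed L -> C `<=` L ->
  prevails L L -> C z -> closure (~` L) z -> closed (L `\` C).
Proof.
move=> cL CL goodL Cz; set D := closure (~` L) => Dz.
have cD : closed D by exact: closed_closure.
have Dz1 x : L x -> D x -> x = z.
  move=> Lx Dx; rewrite -(prevails_boundary goodL Lx Dx).
  by rewrite (prevails_boundary goodL (CL _ Cz) Dz).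
apply: contrapT => /existsNP[y /not_implyP[cly nLCy]].
have Ly : L y.
  by rewrite (closure_id L).1 //; apply: closureS cly => u [].
have Cy : C y by apply: contrapT => nCy; apply: nLCy.
have clC u : closure (L `\` C) u -> closure (~` C) u.
  by apply: closureS => v [].
have yz : y = z.
  rewrite -(component_boundary Cy (clC _ cly)) (component_boundary Cz) //.
  by apply: closureS Dz => u nLu /CL.
move: cly {nLCy Ly Cy}; rewrite {}yz => clz.
have [x0 [[Lx0 nCx0] _]] := closure_meet clz openT I.
have [H1 [clH1 CH1 nH1]] := quasi_componentPn nCx0.
have cLH H : clopen H -> closed (L `\` H).
  by move=> [oH _]; rewrite setDE; apply: closedI => //; exact: open_closedC.
have H1n H : H `<=` H1 -> L `\` H !=set0 by move=> HH; exists x0; split=> // /HH.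
have selLH H : clopen H -> H p -> L `\` H !=set0 ->
    (L `\` H) (f (D `|` (L `\` H) `|` C)).
  move=> clH Hp LH0; have CsH := CH clH Hp.
  have cY : closed (D `|` (L `\` H)) by apply: closedU => //; exact: cLH.
  apply: (sel_move hX f_cont coC cY (K2 := D `|` C) (cLH _ clH) _ _ _ (c1 (x :=
    z))) => //.
  - exact: closedU.
  - move=> x [Lx nHx] [Dx|/CsH//]; apply: nHx; rewrite (Dz1 x) //; exact: CsH.
  - move=> F cF F0 FC.
    have [[|]|/FC] : (D `|` (L `\` H) `|` F) (f (D `|` (L `\` H) `|` F)).
    + apply: f_sel; first exact: closedU.
      by have [x Fx] := F0; exists x; right.
    + by right; left.
    + by left.
    + by right; right.
  - by move=> _ ->.
  - rewrite (_ : _ `|` [set z] = D `|` (L `\` H)).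
      by apply: goodL => //; exact: cLH.
    by apply/seteqP; split=> x; [case=> // ->; left|left].
(* The sets [L \ H] are selected against [C], so [p] is a limit of [L \ C]. *)
have pz : p = z.
  suff clp : closure (L `\` C) p.
    rewrite -(component_boundary Cp (clC _ clp)) (component_boundary Cz) //.
    exact: clC.
  move=> B; rewrite nbhsE => -[O [oO Op] OB].
  pose DD := [set D `|` (L `\` H) `|` C | H in [set H | [/\ clopen H, H p & H
    `<=` H1]]].
  have [||||_ [H [clH Hp HH1] <-] HO] := @vnear_limit _ DD setT (fun B => O (f B)).
  - exists (D `|` (L `\` H1) `|` C); exists H1 => //; split=> //.
    exact: CH1.
  - move=> _ _ [A [clA Ap AH] <-] [A' [clA' A'p A'H] <-].
    exists (D `|` (L `\` (A `&` A')) `|` C).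
      by exists (A `&` A') => //; split=> //; [exact: clopenI|move=> x []/AH].
    move=> x [[[Dx|[Lx nx]]|Cx]|[[Dx|[Lx nx]]|Cx]]; try (by right); try (by left;
      left).
      by left; right; split=> // -[].
    by left; right; split=> // -[].
  - move=> x _; apply: subset_closure; have [Cx|/quasi_componentPn[H [clH CsH
      nHx]]] := pselect (C x).
      exists (D `|` (L `\` H1) `|` C); last by right.
      by exists H1 => //; split=> //; exact: CH1.
    exists (D `|` (L `\` (H `&` H1)) `|` C).
      exists (H `&` H1) => //; split=> //; first exact: clopenI.
        by split; [exact: CsH|exact: CH1].
    have [Lx|nLx] := pselect (L x); first by left; right; split=> // -[].
    by left; left; exact: subset_closure.
  - apply: (@f_cont setT O) => //; first by exists p.
    by rewrite fT.
  have LH0 := H1n H HH1.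
  exists (f (D `|` (L `\` H) `|` C)); split.
    by have [Lf nHf] := selLH H clH Hp LH0; split=> // /(CH clH Hp).
  apply: OB; apply: HO => //; last by exists p; right.
  by apply: closedU => //; apply: closedU => //; exact: cLH.
(* From now on [p] is a limit of both [L \ C] and the complement of [L]. *)
have Dp : D p by rewrite pz.
pose I K Z M := exists H, [/\ [/\ clopen K, K p & L `\` K !=set0],
  [/\ clopen H, H p & H `<=` K], M = ~` H, closed Z /\ ~` K `<=` Z &
  forall F, closed F -> F !=set0 -> F `<=` H -> ~ K (f (Z `|` F))].
have step K : clopen K -> K p -> L `\` K !=set0 -> exists Z M, I K Z M.
  move=> clK Kp LK0.
  have cLK := cLH K clK.
  have cDH H : clopen H -> closed (D `\` H).
    by move=> [oH _]; rewrite setDE; apply: closedI => //; exact: open_closedC.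
  pose DD := [set ((D `\` H) `|` (L `\` K)) `|` [set p] |
    H in [set H | [/\ clopen H, H p & H `<=` K]]].
  have DDK : DD (((D `\` K) `|` (L `\` K)) `|` [set p]).
    by exists K => //; split=> //; exact: subset_refl.
  have [||||_ [H [clH Hp HK] <-] HnK] :=
    @vnear_limit _ DD (D `|` (L `\` K)) (fun B => (~` K) (f B)).
  - by exists (((D `\` K) `|` (L `\` K)) `|` [set p]).
  - move=> _ _ [A [clA Ap AH] <-] [A' [clA' A'p A'H] <-].
    exists ((D `\` (A `&` A')) `|` (L `\` K) `|` [set p]).
      by exists (A `&` A') => //; split=> //; [exact: clopenI|move=> x []/AH].
    move=> x [[[[Dx nx]|LKx]|px]|[[[Dx nx]|LKx]|px]];
      try (by right); try (by left; right).
      by left; left; split=> // -[].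
    by left; left; split=> // -[].
  - move=> x [|LKx].
      apply: closureS => u nLu; have nCu : ~ C u by move=> /CL.
      have [H [clH CsH nHu]] := quasi_componentPn nCu.
      exists ((D `\` (H `&` K)) `|` (L `\` K) `|` [set p]).
        exists (H `&` K) => //; split=> //; first exact: clopenI.
          by split=> //; exact: CsH.
      by left; left; split; [exact: subset_closure|case].
    apply: subset_closure; exists (((D `\` K) `|` (L `\` K)) `|` [set p]) => //.
    by left; right.
  - apply: (@f_cont _ (~` K)).
    + exact: closedU.
    + by exists p; left.
    + by case: (clopen_setC clK).
    + by have [] : (L `\` K) (f (D `|` (L `\` K))) by apply: goodL => // x [].
  have cY : closed ((D `\` H) `|` (L `\` K)) by apply: closedU => //; exact: cDH.
  have [|W [oW CW WF]] := component_near cY (clopen_setC clK) _.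
    apply: HnK; [exact: closedU|exact: setU1_ne|exact: subset_refl|].
    by move=> x [[[Dx _]|LKx]|->]; [left|right|left].
  have [||H' [clH' H'p H'W]] := @clopen_base_component (W `&` H).
  - by apply: openI => //; case: clH.
  - by move=> x Cx; split; [exact: CW|exact: CH Cx].
  exists ((D `\` H) `|` (L `\` K)), (~` H'), H'; split=> //.
  - by split=> // x /H'W[_ /HK].
  - split=> // x nKx; have [Lx|nLx] := pselect (L x); first by right.
    by left; split; [exact: subset_closure|move/HK].
  - by move=> F cF F0 FH; apply: WF => // x /FH/H'W[].
apply: (@no_approach_scheme I).
- move=> K Z M [H [[clK Kp LK0] [clH Hp HK] -> [cZ KZ] HF]]; split.
    by split=> //; split.
  by move=> F cF F0; rewrite setCK; exact: HF.
- move=> K Z M [H [[clK Kp [x [Lx nKx]]] [clH Hp HK] -> [cZ KZ] HF]].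
  have [|Z' [M' IM']] := step H clH Hp.
    by exists x; split=> // /HK.
  have [H' [_ [_ _ H'H] M'E [_ nHZ'] _]] := IM'.
  by exists H, Z', M'; split=> //; rewrite M'E; exact: subsetC.
have [Z [M IM]] := step H1 clH1 (CH1 _ Cp) (H1n H1 (@subset_refl _ _)).
by exists H1, Z, M.
Qed.

End ClopenBase.

(** * Selections on a connected set *)
Section ConnectedSelections.
Variable X : topologicalType.
Hypothesis hX : hausdorff_space X.
Variable f : set X -> X.
Hypotheses (f_sel : set_selection f) (f_cont : set_continuous f).
Variables C Y : set X.
Hypotheses (coC : connected C) (cC : closed C) (cY : closed Y).
Hypothesis selC : forall F, closed F -> F !=set0 -> F `<=` C -> F (f (Y `|` F)).

Let c1 (x : X) : closed [set x]. Proof. exact: hausdorff_closed1. Qed.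
#[local] Hint Resolve c1 : core.

(** By induction on finite sets. If [y0] is the first point selected instead of
[x], then the points that lose against the finite set [F0] built so far form a
connected set [B] containing [F0] and [x]. Moving [F0] to [x] inside [B] keeps
[y0] selected, against the hypothesis on the pair [{x, y0}]. *)
Lemma sel_extreme x : C x ->
  (forall y, C y -> f (Y `|` ([set x] `|` [set y])) = x) ->
  forall F, closed F -> F `<=` C -> F x -> f (Y `|` F) = x.
Proof.
move=> Cx Hx.
suff fin (s : seq X) : [set` s] `<=` C -> f (Y `|` ([set x] `|` [set` s])) = x.
  move=> F cF FC Fx.
  have -> : Y `|` F = (Y `|` [set x]) `|` F.
    by apply/seteqP; split=> y; [case; [left; left|right]|case=> [[|->]|];
      [left|right|right]].
  apply: (@sel_dense _ hX _ f_cont (Y `|` [set x]) F F [set x]) => //.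
  - exact: closedU.
  - by exists x.
  - exact: subset_closure.
  - by move=> s _ sF; rewrite -setUA; apply: fin => y /sF/FC.
elim: s => [_|y0 s IH sC].
  by rewrite classical_sets.set_nil setU0 -[in LHS](setUid [set x]) Hx.
have sC' : [set` s] `<=` C by move=> y ys; apply: sC; rewrite /= inE ys orbT.
have Cy0 : C y0 by apply: sC; rewrite /= inE eqxx.
set F0 := [set x] `|` [set` s].
have fF0 : f (Y `|` F0) = x by exact: IH.
have -> : [set x] `|` [set` y0 :: s] = F0 `|` [set y0].
  by rewrite set_seq_cons (setUC [set y0]) setUA.
have F0C : F0 `<=` C by move=> y [->|/sC'].
have cF0 : closed F0 by apply: closedU => //; exact: closed_seq.
have cYF0 : closed (Y `|` F0) by exact: closedU.
rewrite setUA; set h := fun y => f (Y `|` F0 `|` [set y]).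
have hC y : C y -> F0 (h y) \/ h y = y.
  move=> Cy; rewrite /h -setUA.
  have : (F0 `|` [set y]) (f (Y `|` (F0 `|` [set y]))).
    by apply: selC; [exact: closedU|exact: setU1_ne|move=> z [/F0C//|->]].
  by [].
have hF0 y : F0 y -> h y = x.
  move=> F0y; rewrite -fF0 /h; congr f; apply/seteqP; split=> z; last by left.
  by move=> [//|->]; right.
rewrite -/(h y0); apply: contrapT => hy0x.
have hy0 : h y0 = y0.
  pose s' := [seq y <- s | y != x].
  have : C `<=` [set y | h y = y] `|` [set y | [set x] (h y)].
    move/connected_closed2P: coC => H; apply: (H _ [set y | [set` s'] (h y)]).
    - by apply: closedU; [exact: closed_fix|exact: closed_sel1].
    - by apply: closed_sel1 => //; exact: closed_seq.
    - move=> y Cy; have [F0h|] := hC _ Cy; last by left; left.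
      have [hx|hx] := eqVneq (h y) x; first by left; right.
      right; rewrite /= mem_filter hx /=.
      by case: F0h => // hx'; rewrite hx' eqxx in hx.
    - move=> y Cy; rewrite /= mem_filter => -[hyy|->]; last by rewrite eqxx.
      rewrite hyy => /andP[yx ys]; move: yx; rewrite -hyy hF0 ?eqxx //.
      by right.
    - by exists x; split=> //; right; apply: hF0; left.
  by move=> /(_ _ Cy0)[].
have y0x : y0 <> x by move=> y0x; apply: hy0x; rewrite hy0.
pose A := C `&` [set y | h y = y]; pose B := C `&` [set y | F0 (h y)].
have cA : closed A by apply: closedI => //; exact: closed_fix.
have cB : closed B by apply: closedI => //; exact: closed_sel1.
have BA : B `&` A = [set x].
  apply/seteqP; split=> [y [[_ F0h] [_ hyy]]|_ ->].
    by move: F0h => /=; rewrite hyy => F0y; rewrite /= -hyy hF0.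
  have F0x : F0 x by left.
  by split; split=> //=; rewrite hF0.
have CBA : C = B `|` A.
  apply/seteqP; split=> [y Cy|y [[]//|[]//]].
  by have [|] := hC _ Cy; [left|right].
have coB := connected_half coC cB cA CBA BA.
have cYy : closed (Y `|` [set y0]) by exact: closedU.
have F0B : F0 `<=` B by move=> y F0y; split; [exact: F0C|rewrite /= hF0 //; left].
have xB : [set x] `<=` B by move=> _ ->; apply: F0B; left.
have B0 : F0 !=set0 by exists x; left.
have : [set y0] (f (Y `|` [set y0] `|` [set x])).
  apply: (sel_move hX f_cont coB cYy (K2 := B) _ cB _ _ cF0 B0 F0B _ _ xB) => //.
  - by move=> y -> By0; apply: y0x; have : (B `&` A) y0 by []; rewrite BA.
  - move=> F cF F1 FB; rewrite -setUA.
    have : ([set y0] `|` F) (f (Y `|` ([set y0] `|` F))).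
      apply: selC; first exact: closedU.
      + by exists y0; left.
      + by move=> y [->//|/FB[]].
    by move=> [|/FB]; [left|right].
  - by rewrite -setUA (setUC [set y0]) setUA.
rewrite -setUA (setUC [set y0]) Hx // => xy0.
exact: y0x.
Qed.

(** By [sel_extreme] only pairs matter. If [x] is selected from [{p, x}], it
cuts [C] into the part [A] of the points that win against [x] and the part [B],
containing [p], of those that lose. If [A] is just [x], then [x] is extreme and
would be selected from [C]. Otherwise subsets of [A] without [x] win against
[B], so that the value on [C] lies in [A], which does not contain [p]. *)
Lemma sel_maximal p : C p -> f (Y `|` C) = p ->
  forall F, closed F -> F `<=` C -> F p -> f (Y `|` F) = p.
Proof.
move=> Cp fC; apply: sel_extreme => // x Cx.
have C0 : C !=set0 by exists p.
have pair u v : C u -> C v -> f (Y `|` ([set u] `|` [set v])) = u \/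
    f (Y `|` ([set u] `|` [set v])) = v.
  move=> Cu Cv; have : ([set u] `|` [set v]) (f (Y `|` ([set u] `|` [set v]))).
    by apply: selC; [exact: closedU|exists u; left|move=> z [->|->]].
  by [].
have [//|fpx] := pair p x Cp Cx; rewrite fpx; apply: contrapT => xp.
have cYx : closed (Y `|` [set x]) by exact: closedU.
have cYp : closed (Y `|` [set p]) by exact: closedU.
set h := fun y => f (Y `|` [set x] `|` [set y]).
pose A := C `&` [set y | h y = y]; pose B := C `&` [set y | [set x] (h y)].
have cA : closed A by apply: closedI => //; exact: closed_fix.
have cB : closed B by apply: closedI => //; exact: closed_sel1.
have hx : h x = x by rewrite /h -setUA; have [] := pair x x Cx Cx.
have AB : A `&` B = [set x].
  apply/seteqP; split=> [y [[_ hyy] [_ hyx]]|_ ->//].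
  by move: hyy hyx => /= ->.
have CAB : C = A `|` B.
  apply/seteqP; split=> [y Cy|y [[]//|[]//]].
  by have := pair x y Cx Cy; rewrite setUA => -[|]; [right|left].
have Bp : B p by split; rewrite //= /h -setUA (setUC [set x]).
have nAp : ~ A p.
  by move=> Ap; have : (A `&` B) p by []; rewrite AB => px; apply: xp.
have Ax : A x by [].
have Bx : B x by [].
have coA := connected_half coC cA cB CAB AB.
have coB : connected B.
  apply: (@connected_half _ C B A x) => //; first by rewrite setUC.
  by rewrite setIC.
have [a0 [Aa0 a0x]] : exists a, A a /\ a <> x.
  apply: contrapT => nA; apply: xp; rewrite -fC; symmetry.
  apply: sel_extreme => // y Cy.
  have [//|fy] := pair x y Cx Cy; rewrite fy.
  by apply: contrapT => yx; apply: nA; exists y; split=> //; split=> //=;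
    rewrite /h -setUA.
have stepA F : closed F -> F !=set0 -> F `<=` A -> A (f (Y `|` [set p] `|` F)).
  move=> cF F0 FA.
  apply: (sel_move hX f_cont coA cYp (K2 := [set p]) (F0 := [set x]) cA) => //.
  - by move=> y Ay yp; apply: nAp; rewrite -yp.
  - move=> G cG G0 GA; rewrite -setUA.
    have : ([set p] `|` G) (f (Y `|` ([set p] `|` G))).
      apply: selC; first exact: closedU.
      + by exists p; left.
      + by move=> y [->//|/GA[]].
    by move=> [|/GA]; [right|left].
  - by move=> _ ->.
  - by rewrite -setUA fpx.
have pB : [set p] `<=` B by move=> _ ->.
have B0 : B !=set0 by exists p.
have stepB F : closed F -> F !=set0 -> F `<=` A `\ x -> A (f (Y `|` F `|` B)).
  move=> cF F0 FA; have FA' : F `<=` A by move=> y /FA[].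
  have cYF : closed (Y `|` F) by exact: closedU.
  apply/FA'.
  apply: (sel_move hX f_cont coB cYF (K2 := B) cF cB _ _ (c1 (x := p)) (set1_ne
    p) pB cB B0) => //.
  - move=> y Fy By; have [Ay yx] := FA _ Fy.
    by apply: yx; have : (A `&` B) y by []; rewrite AB.
  - move=> G cG G0 GB; rewrite -setUA.
    have : (F `|` G) (f (Y `|` (F `|` G))).
      apply: selC; first exact: closedU.
      + by have [y Gy] := G0; exists y; right.
      + by move=> y [/FA'[]//|/GB[]].
    by move=> [|/GB]; [left|right].
  - have := stepA F cF F0 FA'; rewrite -!setUA (setUC [set p]) => Af.
    have : (F `|` [set p]) (f (Y `|` (F `|` [set p]))).
      by apply: selC; [exact: closedU|exact: setU1_ne|move=> y [/FA'[]//|->]].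
    by move=> [//|fp]; case: nAp; rewrite -fp.
apply: nAp; rewrite -fC.
have clA : closure (A `\ x) `<=` A.
  by rewrite [X in _ `<=` X](closure_id A).1 //; apply: closureS => y [].
have -> : Y `|` C = (Y `|` B) `|` closure (A `\ x).
  rewrite CAB; apply/seteqP; split=> y.
    move=> [|[Ay|]]; [by left; left| |by left; right].
    have [->|yx] := pselect (y = x); first by left; right.
    by right; apply: subset_closure.
  by move=> [[|]|/clA]; [left|right; right|right; left].
apply: (@sel_dense _ hX _ f_cont (Y `|` B) (closure (A `\ x)) (A `\ x) A) => //.
- exact: closedU.
- exact: closed_closure.
- by exists a0.
- exact: subset_closure.
- move=> s s0 sA; have := @stepB [set` s] (closed_seq hX) s0 sA.
  by rewrite -!setUA (setUC B).
Qed.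

End ConnectedSelections.

(** * Descending towers of sets *)
Section Tower.
Variables (T : Type) (next : set T -> set T).
Hypothesis next_sub : forall E, next E `<=` E.
Implicit Types (E A B S : set T) (D : set (set T)).

(** The smallest family containing the whole set (the empty intersection) and
closed under [next] and intersections: a well-ordered descending chain, without
ordinals. *)
Inductive tower : set T -> Prop :=
| tower_next E : tower E -> tower (next E)
| tower_bigcap D : (forall E, D E -> tower E) -> tower (\bigcap_(E in D) E).

Lemma tower_setT : tower setT.
Proof. by rewrite -(bigcap_set0 (fun E : set T => E)); exact: tower_bigcap. Qed.

(** Nothing lies strictly between [B] and [next B]. The successor step for [A]
uses the statement for the pairs [(A, B)] and [(B, A)], whence a second
induction, on [B], inside the first. *)
Lemma tower_linear A B : tower A -> tower B -> B `<=` A \/ A `<=` next B.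
Proof.
have stepR A' B' : B' `<=` A' \/ A' `<=` next B' -> A' `<=` B' \/ B' `<=` next A' ->
    B' `<=` next A' \/ next A' `<=` next B'.
  move=> [BA|AB _]; last by right; exact: subset_trans (@next_sub _) AB.
  by move=> [AB|]; [right; have -> : A' = B' by apply/seteqP|left].
have capR D B' : (forall A', D A' -> B' `<=` A' \/ A' `<=` next B') ->
    B' `<=` \bigcap_(A' in D) A' \/ \bigcap_(A' in D) A' `<=` next B'.
  move=> DR; have [H|] := pselect (forall A', D A' -> B' `<=` A').
    by left=> x B'x A' DA'; exact: (H _ DA').
  move=> /existsNP[A' /not_implyP[DA' nBA]]; right=> x /(_ _ DA').
  by have [//|] := DR _ DA'; apply.
move=> tA; elim: tA B => {A} [A tA IHA|D tD IHD] B tB; last first.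
  by apply: (capR) => A' DA'; exact: IHD.
apply: (stepR); first exact: IHA.
elim: tB => {B} [B tB IHB|D tD IHD]; last exact: capR.
by apply: (stepR) => //; exact: IHA.
Qed.

Lemma tower_total A B : tower A -> tower B -> B `<=` A \/ A `<=` B.
Proof.
move=> tA tB; have [|AB] := tower_linear tA tB; first by left.
by right; exact: subset_trans AB (@next_sub _).
Qed.

Lemma tower_fix_least A B : tower A -> next A = A -> tower B -> A `<=` B.
Proof.
move=> tA nA; elim=> {B} [B tB AB|D tD IHD]; last first.
  by move=> x Ax E DE; exact: (IHD _ DE).
have [BA|//] := tower_linear tA tB.
by rewrite (_ : B = A) ?nA//; apply/seteqP.
Qed.

(** The smallest member of the tower that could meet [S]; that it does meet [S]
is a compactness property, shown in [tower_last_meets] for the tower used here.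
*)
Definition tower_last S := \bigcap_(E in [set E | tower E /\ E `&` S !=set0]) E.
Definition tower_above E := [set E' | [/\ tower E', E `<=` E' & E' <> E]].
(** The immediate predecessor of [E], or [E] itself when [E] is a limit of the
tower. *)
Definition tower_pre E := \bigcap_(E' in tower_above E) E'.
Definition tower_bot := \bigcap_(E in tower) E.

Lemma tower_tower_last S : tower (tower_last S).
Proof. by apply: tower_bigcap => E []. Qed.

Lemma tower_tower_bot : tower tower_bot.
Proof. exact: tower_bigcap. Qed.

Lemma tower_bot_fix : next tower_bot = tower_bot.
Proof.
apply/seteqP; split; first exact: next_sub.
by move=> x; apply; apply: tower_next; exact: tower_tower_bot.
Qed.

Lemma tower_last_sub S E : tower E -> E `&` S !=set0 -> tower_last S `<=` E.
Proof. by move=> tE ES x; apply. Qed.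

Lemma sub_tower_last S E : tower E -> E `&` S = set0 -> E `<=` tower_last S.
Proof.
move=> tE ES x Ex E' [tE' [y [E'y Sy]]].
have [EE'|E'E] := tower_total tE' tE; first exact: EE'.
suff : (E `&` S) y by rewrite ES.
by split=> //; exact: E'E.
Qed.

Lemma sub_tower_pre E : E `<=` tower_pre E.
Proof. by move=> x Ex E' [_ EE' _]; exact: EE'. Qed.

Lemma above_next E E' : tower E -> tower_above E E' -> E `<=` next E'.
Proof.
move=> tE [tE' EE' E'E]; have [E'sE|//] := tower_linear tE tE'.
by case: E'E; apply/seteqP.
Qed.

Lemma above_next_neq E E' : tower E -> tower_above E E' -> next E' <> E'.
Proof.
move=> tE [tE' EE' E'E] nE'; apply: E'E; apply/seteqP; split=> //.
exact: tower_fix_least.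
Qed.

Lemma above_next_limit E E' : tower E -> tower_pre E = E -> tower_above E E' ->
  tower_above E (next E').
Proof.
move=> tE pE aE'; have EnE' := above_next tE aE'; have [tE' EE' E'E] := aE'.
split=> //; first exact: tower_next.
move=> nE'; apply: E'E; apply/seteqP; split=> // x E'x;
  rewrite -pE => E'' [tE'' EE'' nE''].
have [|E''n] := tower_linear tE'' tE'; first by apply.
by case: nE''; apply/seteqP; split=> // y /E''n; rewrite nE'.
Qed.

Lemma tower_last_eq S E : tower E -> next E `&` S = set0 -> E `&` S !=set0 ->
  tower_last S `&` S !=set0 -> tower_last S = E.
Proof.
move=> tE nES ES lS; apply/seteqP; split; first exact: tower_last_sub.
have [//|ln] := tower_linear (tower_tower_last S) tE.
have [x [lx Sx]] := lS; suff : (next E `&` S) x by rewrite nES.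
by split=> //; exact: ln.
Qed.

Lemma tower_above_dir E A B : tower_above E A -> tower_above E B ->
  exists2 G, tower_above E G & G `<=` A `&` B.
Proof.
move=> aA aB; have [tA EA nA] := aA; have [tB EB nB] := aB.
have [BA|AB] := tower_total tA tB; first by exists B => // x Bx; split=> //;
  exact: BA.
by exists A => // x Ax; split=> //; exact: AB.
Qed.

End Tower.

(** * The maximal selection *)
Section MaximalSelection.
Variable X : topologicalType.
Hypothesis hX : hausdorff_space X.
Variable f : set X -> X.
Hypotheses (f_sel : set_selection f) (f_cont : set_continuous f).
Variable p : X.
Hypothesis fT : f setT = p.
Hypothesis nOmega : ~ countably_approachable p.
Implicit Types (A B E F H N O S V : set X) (P : set X -> Prop).

Let c1 (x : X) : closed [set x]. Proof. exact: hausdorff_closed1. Qed.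
#[local] Hint Resolve c1 : core.

Let C := quasi_component p.
Let Cp : C p. Proof. exact: quasi_component_refl. Qed.
Let cC : closed C. Proof. exact: quasi_component_closed. Qed.
Let CH H : clopen H -> H p -> C `<=` H. Proof. by move=> clH Hp x; apply. Qed.
Let tameP U : open U -> C `<=` U -> exists H, tame f p H /\ H `<=` U.
Proof. exact: (tame_base hX f_sel f_cont fT nOmega). Qed.

(** A step goes to a strictly smaller tame set winning against what was left;
the tower stops when there is none. *)
Definition tame_step E H := [/\ tame f p H, H `<=` E, H <> E & prevails f E H].
Definition tame_next E := xget E (tame_step E).

Lemma tame_next_sub E : tame_next E `<=` E.
Proof. by rewrite /tame_next; case: xgetP => [H _ []|_ x]. Qed.

Lemma tame_nextP E : tame_next E <> E -> tame_step E (tame_next E).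
Proof. by rewrite /tame_next; case: xgetP => [H _ EH _|_]. Qed.

Lemma tame_next_neq E H : tame_step E H -> tame_next E <> E.
Proof. by move=> EH; have [] : tame_step E (tame_next E) by exact: (xgetI E EH).
  Qed.

Local Notation tow := (tower tame_next).
Local Notation last_ := (tower_last tame_next).
Local Notation pre := (tower_pre tame_next).
Local Notation bot := (tower_bot tame_next).
Let sub := tame_next_sub.

Lemma tower_inv E : tow E ->
  [/\ closed E, C `<=` E & tame f p E \/ pre E = E].
Proof.
elim=> {E} [E tE [cE CE tpE]|D tD IHD].
  have [->//|/tame_nextP[tH _ _ _]] := pselect (tame_next E = E).
  have [[oH cH] Hp _] := tH; split=> //; last by left.
  exact: (CH (conj oH cH) Hp).
split.
- by apply: closed_bigI => E /IHD[].
- by move=> x Cx E /IHD[_ CE _]; exact: CE.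
have [DE|nDE] := pselect (D (\bigcap_(E in D) E)); first by have [] := IHD _ DE.
right; apply/seteqP; split; last exact: sub_tower_pre.
move=> x prex E DE; apply: prex; split; first exact: tD.
  by move=> y; apply.
by move=> EE; apply: nDE; rewrite -EE.
Qed.

(** Passing to the limit over the members above [E], each of which is followed
by a set containing [E]. *)
Lemma tower_pre_sel E F : tow E -> closed F -> F !=set0 -> F `<=` E ->
  F (f (closure (~` pre E) `|` F)).
Proof.
move=> tE cF F0 FE.
have [[E0 aE0]|nE0] := pselect (tower_above tame_next E !=set0); last first.
  rewrite /tower_pre (_ : tower_above _ _ = set0).
    by rewrite bigcap_set0 setCT closure0 set0U; exact: f_sel.
  by apply/seteqP; split=> // E' aE'; apply: nE0; exists E'.
apply: (sel_bigcap f_cont (E_ := tower_above tame_next E)) => //;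
  first by exists E0.
  by move=> A B aA aB; exact: (tower_above_dir sub).
move=> E' aE'.
have [_ _ _ HF] := tame_nextP (above_next_neq sub tE aE').
by apply: HF => // x /FE; exact: (above_next sub tE aE').
Qed.

(** A tame bottom different from [C] allows a further step, by [sel_near], and
so does a limit bottom whose boundary misses [C]. There remains a limit bottom
with boundary point in [C], to which [prevails_diff_closed] applies. *)
Lemma bot_diff_clopen : clopen (bot `\` C).
Proof.
have tb := tower_tower_bot tame_next; have nb := tower_bot_fix sub.
have [cb Cb tpb] := tower_inv tb.
have nostep H : ~ tame_step bot H by move=> /tame_next_neq; rewrite nb.
have [tb'|ntb] := pselect (tame f p bot).
  suff -> : bot `\` C = set0 by exact: clopen0.
  apply/seteqP; split=> // x [bx nCx].
  have [clb bp bf] := tb'; have clnb := (clopen_setC clb).2.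
  have [W [oW CW WF]] := component_near hX f_sel f_cont clnb clb bf.
  have [||H [tH HW]] := @tameP (W `&` bot `&` ~` [set x]).
  - by apply: openI; [apply: openI => //; case: clb|exact: closed_openC].
  - by move=> y Cy; split; [split; [exact: CW|exact: Cb]|move=> yx; apply: nCx;
      rewrite -yx].
  apply: (nostep H); split=> //; first by move=> y /HW[[]].
    move=> Hb; have Hx : H x by rewrite Hb.
    by have [_] := HW _ Hx; apply.
  move=> F cF F0 FH; rewrite -(closure_id _).1 //.
  have [nbf|//] : (~` bot `|` F) (f (~` bot `|` F)).
    by apply: f_sel; [exact: closedU|have [y Fy] := F0; exists y; right].
  by case: nbf; apply: WF => // y /FH/HW[[]].
(* The tower now stops at a limit, so the bottom prevails over its complement. *)
have {tpb} pb : pre bot = bot by case: tpb.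
have goodb : prevails f bot bot.
  by move=> F cF F0 Fb; rewrite -{1}pb; exact: tower_pre_sel.
have [[z [Cz clz]]|nz] := pselect (C `&` closure (~` bot) !=set0); last first.
  have [||H [tH HW]] := @tameP (~` closure (~` bot)).
  - by apply: closed_openC; exact: closed_closure.
  - by move=> x Cx clx; apply: nz; exists x.
  have Hb : H `<=` bot.
    by move=> x /HW nclx; apply: contrapT => nbx; apply: nclx;
      exact: subset_closure.
  case: (nostep H); split=> //; first by move=> HE; apply: ntb; rewrite -HE.
  by move=> F cF F0 FH; apply: goodb => // x /FH/Hb.
split; last exact: (prevails_diff_closed hX f_sel f_cont fT nOmega cb Cb goodb Cz
  clz).
rewrite (_ : _ `\` _ = ~` closure (~` bot) `&` ~` C).
  by apply: openI; apply: closed_openC => //; exact: closed_closure.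
apply/seteqP; split=> x [bx nCx]; split=> //.
  move=> clx; apply: nCx; rewrite -(prevails_boundary hX goodb bx clx).
  by rewrite (prevails_boundary hX goodb (Cb _ Cz) clz).
by apply: contrapT => nbx; apply: bx; exact: subset_closure.
Qed.

(** If [S] missed [E = tower_last S], then [E] would be a limit of members
meeting [S]. Their complements together with the traces of [S] on smaller
members converge to [closure (~ E)], and the value lies in the traces; by
continuity [f (closure (~ E))] is a point of all the traces, hence of [S n E].
*)
Lemma tower_last_meets S : closed S -> S !=set0 -> last_ S `&` S !=set0.
Proof.
move=> cS [s0 Ss0]; apply: contrapT => nE.
set E := last_ S in nE; have tE : tow E by exact: tower_tower_last.
have [cE CE _] := tower_inv tE.
have nES x : E x -> S x -> False by move=> Ex Sx; apply: nE; exists x.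
pose FS := [set E' | tow E' /\ E' `&` S !=set0].
have FST : FS setT by split; [exact: tower_setT|exists s0].
have FStot A B : FS A -> FS B -> exists2 G, FS G & G `<=` A `&` B.
  move=> FA FB; have [tA _] := FA; have [tB _] := FB.
  have [BA|AB] := tower_total sub tA tB; first by exists B => // x Bx; split=> //;
    exact: BA.
  by exists A => // x Ax; split=> //; exact: AB.
have FSabove A : FS A -> tower_above tame_next E A.
  move=> [tA AS]; split=> //; first exact: tower_last_sub.
  by move=> AE; apply: nE; rewrite -AE.
set M := closure (~` E).
have cM : closed M by exact: closed_closure.
have M0 : M !=set0 by exists s0; apply: subset_closure => /nES; apply.
set y := f M.
have [E1 FE1 nSE1] : exists2 E1, FS E1 & ~ (S `&` E1) y.
  have [Sy|nSy] := pselect (S y); last by exists setT => // -[].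
  have : ~ E y by move=> /nES; apply.
  by move=> /existsNP[E1 /not_implyP[FE1 nE1]]; exists E1 => // -[].
have cSE1 : closed (S `&` E1).
  by apply: closedI => //; have [] := tower_inv FE1.1.
pose D := [set closure (~` E') | E' in FS].
have [||||_ [E' FE' <-] HB] := @vnear_limit _ D M (fun B => (~` (S `&` E1)) (f B)).
- by exists (closure (~` setT)), setT.
- move=> _ _ [A FA <-] [B FB <-]; have [G FG GAB] := FStot A B FA FB.
  exists (closure (~` G)); first by exists G.
  by move=> x [|]; apply: closureS => u nu /GAB[].
- rewrite /M /E /tower_last setC_bigcap; apply: closureS => x [A FA nAx].
  by exists (closure (~` A)); [exists A|exact: subset_closure].
- by apply: (@f_cont M (~` (S `&` E1))) => //; exact: closed_openC.
have aE' := FSabove _ FE'.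
have [_ _ _ HF] := tame_nextP (above_next_neq sub tE aE').
have [E3 FE3 nE'3] : exists2 E3, FS E3 & ~ E' `<=` E3.
  apply: contrapT => H; have [_ EE' E'E] := aE'; apply: E'E; apply/seteqP;
    split=> // x E'x A FA.
  by apply: contrapT => nAx; apply: H; exists A => // E'A; exact/nAx/E'A.
have E3n : E3 `<=` tame_next E'.
  by have [//|] := tower_linear sub FE3.1 FE'.1.
have [E2 FE2 E2s] := FStot _ _ FE1 FE3.
have [t2 [u [E2u Su]]] := FE2.
have cSE2 : closed (S `&` E2) by apply: closedI => //; have [] := tower_inv t2.
have SE20 : S `&` E2 !=set0 by exists u.
have [Sf E2f] : (S `&` E2) (f (closure (~` E') `|` (S `&` E2))).
  by apply: HF => // v [_ /E2s[_ /E3n]].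
apply: (HB (closure (~` E') `|` (S `&` E2))).
- by apply: closedU => //; exact: closed_closure.
- by exists u; right.
- by move=> v; left.
- move=> v [|[Sv _]]; first by apply: closureS =>
    w nw /(tower_last_sub FE'.1 FE'.2).
  by apply: subset_closure => /nES; apply.
- by split=> //; have [] := E2s _ E2f.
Qed.

(** The set to which [f] is applied when [S] avoids the bottom of the tower. *)
Definition tower_part S := closure (~` pre (last_ S)) `|` (S `&` last_ S).

Lemma closed_tower_part S : closed S -> closed (tower_part S).
Proof.
move=> cS; apply: closedU; first exact: closed_closure.
apply: closedI => //; have [] := tower_inv (tower_tower_last tame_next S).
by [].
Qed.

Lemma tower_part_sel S : closed S -> S !=set0 ->
  (S `&` last_ S) (f (tower_part S)).
Proof.
move=> cS S0; have tl := tower_tower_last tame_next S;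
  have [cl _ _] := tower_inv tl.
apply: tower_pre_sel => //; [exact: closedI|].
by have [x [lx Sx]] := tower_last_meets cS S0; exists x.
Qed.

(** If [B] misses [E] and meets a member [E2] following some [E1] above [E],
then its last member lies between [E] and [E2], so that [tower_part B] lies
between [closure (~ E1)] and [closure (~ E)]; these are close by [vnear_limit].
*)
Lemma near_limit E O : tow E -> pre E = E -> E <> setT -> open O ->
  O (f (closure (~` E))) -> exists E2, [/\ open E2, E `<=` E2 &
    forall B, closed B -> B !=set0 -> E `&` B = set0 -> E2 `&` B !=set0 ->
      O (f (tower_part B))].
Proof.
move=> tE pE ET oO Of.
pose D := [set closure (~` E') | E' in tower_above tame_next E].
have aT : tower_above tame_next E setT.
  by split=> //; [exact: tower_setT|move=> TE; apply: ET].
have [x nEx] : exists x, ~ E x by apply/existsNP => EE; apply: ET; apply/seteqP;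
  split.
have [||||_ [E1 aE1 <-] HO] := @vnear_limit _ D (closure (~` E)) (fun B => O (f B)).
- by exists (closure (~` setT)), setT.
- move=> _ _ [A aA <-] [B aB <-]; have [G aG GAB] := tower_above_dir sub aA aB.
  exists (closure (~` G)); first by exists G.
  by move=> y [|]; apply: closureS => u nu /GAB[].
- rewrite -{1}pE /tower_pre setC_bigcap; apply: closureS => y [A aA nAy].
  by exists (closure (~` A)); [exists A|exact: subset_closure].
- apply: f_cont => //; first exact: closed_closure.
  by exists x; exact: subset_closure.
have aE2 := above_next_limit sub tE pE aE1; have [tE2 EE2 E2E] := aE2.
have nE1 := above_next_neq sub tE aE1.
have [[[oE2 _] _ _] E21 _ _] := tame_nextP nE1.
exists (tame_next E1); split=> // B cB B0 EB E2B.
have lE2 : last_ B `<=` tame_next E1 by exact: tower_last_sub.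
have [y [ly By]] := tower_last_meets cB B0.
have El : E `<=` last_ B by exact: sub_tower_last.
have preE1 : pre (last_ B) `<=` E1.
  move=> u; apply; split; first by case: aE1.
    exact: subset_trans lE2 E21.
  by move=> E1l; apply: nE1; apply/seteqP; split=> //; rewrite {1}E1l.
apply: HO.
- exact: closed_tower_part.
- by exists y; right.
- by move=> u clu; left; move: clu; apply: closureS => v nv /preE1.
- move=> u [|[Bu lu]].
    by apply: closureS => v nv /El lv; apply: nv; exact: sub_tower_pre lv.
  by apply: subset_closure => Eu; have : (E `&` B) u by []; rewrite EB.
Qed.

(** Let [E = tower_last S]. Sets close to [S] miss [next E]. Those that meet [E]
have the same last member, and [vnear_cut] applies. If sets close to [S] can
miss [E], then [S] meets [E] only in the boundary of [E], so that [E] is a limit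
and [tower_part S] is just [closure (~ E)]: this is the situation of
[near_limit]. *)
Lemma tower_part_cont S O : closed S -> S !=set0 -> bot `&` S = set0 ->
  open O -> O (f (tower_part S)) -> vnear S (fun B => O (f (tower_part B))).
Proof.
move=> cS S0 bS oO Of; set E := last_ S.
have tE : tow E by exact: tower_tower_last.
have [cE CE tpE] := tower_inv tE.
have ES : E `&` S !=set0 by exact: tower_last_meets.
have nEE : tame_next E <> E.
  move=> nE; have [x [Ex Sx]] := ES.
  suff : (bot `&` S) x by rewrite bS.
  split=> // A tA; exact: (tower_fix_least sub tE nE tA).
have tnE : tow (tame_next E) by exact: tower_next.
have nES : tame_next E `&` S = set0.
  apply/seteqP; split=> // x [nEx Sx]; apply: nEE; apply/seteqP; split;
    first exact: sub.
  by apply: tower_last_sub => //; exists x.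
have nearn : vnear S (fun B => B `<=` ~` tame_next E).
  apply: vnear_sub; first by apply: closed_openC; have [] := tower_inv tnE.
  by move=> x Sx nx; have : (tame_next E `&` S) x by []; rewrite nES.
have lastE B : closed B -> B !=set0 -> B `<=` ~` tame_next E -> E `&` B !=set0 ->
    last_ B = E.
  move=> cB B0 Bn EB; apply: tower_last_eq => //; last exact: tower_last_meets.
  by apply/seteqP; split=> // x [nx /Bn].
have nearE : E `<=` closure (~` pre E) `|` E° ->
    vnear S (fun B => B `&` E !=set0 -> O (f (tower_part B))).
  move=> EN; have := @vnear_cut _ (closure (~` pre E)) E S (fun B => O (f B))
    (@closed_closure _ _) cE EN.
  have H : vnear (tower_part S) (fun B => O (f B)).
    apply: f_cont => //; first exact: closed_tower_part.
    by have [x [Ex Sx]] := ES; exists x; right.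
  move=> /(_ H) {}H; move: (vnear_and nearn H);
    apply: vnear_mono => B cB B0 [Bn HO] BE.
  rewrite /tower_part lastE //; last by rewrite setIC.
  exact: HO.
have [oE|noE] := pselect (S `&` E° !=set0).
  have EN : E `<=` closure (~` pre E) `|` E°.
    move=> x Ex; have [[[oE' _] _ _]|pE] := tpE.
      by right; rewrite (interior_id E).1.
    by rewrite pE; exact: closureC_or_interior.
  have near0 : vnear S (fun B => B `&` E° !=set0).
    by apply: vnear_meet => //; exact: open_interior.
  move: (vnear_and near0 (nearE EN)); apply: vnear_mono => B cB B0 [[x [Bx Ex]]];
    apply.
  by exists x; split=> //; exact: interior_subset.
have pE : pre E = E.
  case: tpE => // -[[oE _] _ _]; case: noE.
  by have [x [Ex Sx]] := ES; exists x; split=> //; rewrite (interior_id E).1.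
have cln x : S x -> E x -> closure (~` E) x.
  move=> Sx Ex; have [//|Eo] := closureC_or_interior E x.
  by case: noE; exists x.
have EN : E `<=` closure (~` pre E) `|` E°.
  by move=> x _; rewrite pE; exact: closureC_or_interior.
have partE : tower_part S = closure (~` E).
  rewrite /tower_part -/E pE; apply/seteqP; split=> x; last by left.
  by case=> // -[Sx Ex]; exact: cln.
have ET : E <> setT.
  move=> EE; case: noE; have [x Sx] := S0; exists x; split=> //.
  by rewrite EE interiorT.
rewrite partE in Of.
have [E2 [oE2 EE2 HE2]] := near_limit tE pE ET oO Of.
have near2 : vnear S (fun B => B `&` E2 !=set0).
  apply: vnear_meet => //; have [x [Ex Sx]] := ES; exists x; split=> //; exact: EE2.
move: (vnear_and near2 (nearE EN)); apply: vnear_mono => B cB B0 [BE2 HB].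
have [|BE] := pselect (B `&` E !=set0); first exact: HB.
apply: HE2 => //; last by rewrite setIC.
by apply/seteqP; split=> // x [Ex Bx]; apply: BE; exists x.
Qed.

Let V := bot `\` C.

(** The clopen remainder [V] of the bottom of the tower comes last: a set with a
point in [V] may lose its points in [C] under small perturbations, and these
then move to the tower outside [V]. *)
Definition maximal_selection S :=
  if `[< S `&` C !=set0 >] then f (closure (~` C) `|` (S `&` C))
  else if `[< S `\` V !=set0 >] then f (tower_part (S `\` V)) else f S.

Let clV : clopen V. Proof. exact: bot_diff_clopen. Qed.

Let closed_diff S : closed S -> closed (S `\` V).
Proof.
by move=> cS; rewrite setDE; apply: closedI => //; case: (clopen_setC clV).
Qed.

Let bot_diff S : S `&` C = set0 -> bot `&` (S `\` V) = set0.
Proof.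
move=> SC; apply/seteqP; split=> // x [bx [Sx nVx]].
have [Cx|nCx] := pselect (C x); last by apply: nVx.
by have : (S `&` C) x by []; rewrite SC.
Qed.

Let mselC S : S `&` C !=set0 ->
  maximal_selection S = f (closure (~` C) `|` (S `&` C)).
Proof. by move=> /asboolP; rewrite /maximal_selection => ->. Qed.

Let mselT S : S `&` C = set0 -> S `\` V !=set0 ->
  maximal_selection S = f (tower_part (S `\` V)).
Proof.
move=> SC /asboolP SV; rewrite /maximal_selection SV ifF //.
by apply/asboolPn => -[x]; rewrite SC.
Qed.

Lemma maximal_selection_sel : set_selection maximal_selection.
Proof.
move=> S cS S0; have [SC|nSC] := pselect (S `&` C !=set0).
  rewrite mselC //.
  have [] // : (S `&` C) (f (closure (~` C) `|` (S `&` C))).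
  by apply: (component_prevails hX f_sel f_cont fT nOmega) => //; exact: closedI.
have SC : S `&` C = set0 by apply/seteqP; split=> // x SCx; apply: nSC; exists x.
have [SV|nSV] := pselect (S `\` V !=set0).
  rewrite mselT //; have [] := tower_part_sel (closed_diff cS) SV.
  by case.
rewrite /maximal_selection ifF; last exact/asboolPn.
by rewrite ifF; [exact: f_sel|exact/asboolPn].
Qed.

Lemma maximal_selection_max S : closed S -> S p -> maximal_selection S = p.
Proof.
move=> cS Sp; rewrite mselC; last by exists p.
have coC : connected C by exact: (quasi_component_connected hX f_sel f_cont).
apply: (sel_maximal hX f_cont coC cC (@closed_closure _ _) _ Cp) => //.
- by move=> F cF F0 FC; exact: (component_prevails hX f_sel f_cont fT nOmega).
- rewrite -fT; congr f; apply/seteqP; split=> // x _.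
  have [Cx|nCx] := pselect (C x); [by right|left; exact: subset_closure].
- exact: closedI.
Qed.

(** Apart from routine gluing, the delicate sets are those that meet [C] only in
its boundary point [z], while sets nearby miss [C]. There the value [z] is also
[f (closure (~ bot))], since [bot] prevails over its complement and touches it
at [z]; so [near_limit] controls the sets nearby. *)
Lemma maximal_selection_cont : set_continuous maximal_selection.
Proof.
move=> S O cS S0 oO Oh.
have [SC|nSC] := pselect (S `&` C !=set0); last first.
  have SC : S `&` C = set0 by apply/seteqP; split=> // x SCx; apply: nSC; exists x.
  have nearC : vnear S (fun B => B `<=` ~` C).
    apply: vnear_sub; first exact: closed_openC.
    by move=> x Sx Cx; apply: nSC; exists x.
  have BC B : B `<=` ~` C -> B `&` C = set0.
    by move=> BC; apply/seteqP; split=> // x [/BC].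
  have [[x [Sx nVx]]|nSV] := pselect (S `\` V !=set0); last first.
    have nearV : vnear S (fun B => B `<=` V).
      apply: vnear_sub; first by case: clV.
      by move=> x Sx; apply: contrapT => nVx; apply: nSV; exists x.
    have fS B : B `<=` ~` C -> B `<=` V -> maximal_selection B = f B.
      move=> /BC nBC BV; rewrite /maximal_selection ifF; last first.
        by apply/asboolPn => -[x]; rewrite nBC.
      by rewrite ifF //; apply/asboolPn => -[x [/BV]].
    have nearf : vnear S (fun B => O (f B)).
      apply: f_cont => //; rewrite -fS //.
        by move=> x Sx Cx; apply: nSC; exists x.
      by move=> x Sx; apply: contrapT => nVx; apply: nSV; exists x.
    move: (vnear_and (vnear_and nearC nearV) nearf).
    by apply: vnear_mono => B cB B0 [[nBC BV] Of]; rewrite fS.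
  have SV : S `\` V !=set0 by exists x.
  rewrite mselT // in Oh.
  have nearT := tower_part_cont (closed_diff cS) SV (bot_diff SC) oO Oh.
  have [oV' cV'] := clopen_setC clV.
  have nearV : vnear S (fun B => B `&` ~` V !=set0).
    by apply: vnear_meet => //; exists x.
  have := @vnear_cut _ set0 (~` V) S (fun B => O (f (tower_part B))) closed0 cV'.
  rewrite set0U (interior_id _).1 // set0U -setDE => /(_ (@subset_refl _ _) nearT).
  move=> near1; move: (vnear_and (vnear_and nearC nearV) near1).
  apply: vnear_mono => B cB B0 [[nBC BV] OB]; rewrite mselT //.
  - by move: (OB BV); rewrite set0U -setDE.
  - exact: BC.
rewrite mselC // in Oh.
have EN : C `<=` closure (~` C) `|` C°.
  by move=> x _; exact: closureC_or_interior.
have nearC : vnear S (fun B => B `&` C !=set0 -> O (maximal_selection B)).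
  have H : vnear (closure (~` C) `|` (S `&` C)) (fun B => O (f B)).
    apply: f_cont => //.
    - by apply: closedU; [exact: closed_closure|exact: closedI].
    - by have [x Cx] := SC; exists x; right.
  have := vnear_cut (@closed_closure _ _) cC EN H.
  by apply: vnear_mono => B cB B0 HB BC; rewrite mselC //; exact: HB.
have [oC|noC] := pselect (S `&` C° !=set0).
  have near0 : vnear S (fun B => B `&` C° !=set0).
    by apply: vnear_meet => //; exact: open_interior.
  move: (vnear_and near0 nearC); apply: vnear_mono => B cB B0 [[x [Bx Cx]]]; apply.
  by exists x; split=> //; exact: interior_subset.
have cln x : S x -> C x -> closure (~` C) x.
  move=> Sx Cx; have [//|Co] := closureC_or_interior C x.
  by case: noC; exists x.
have [z [Sz Cz]] := SC.
have fz : f (closure (~` C)) = z by apply: (component_boundary hX f_sel f_cont fT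
  nOmega) => //; exact: cln.
have {}Oh : O z.
  move: Oh; rewrite (_ : _ `|` _ = closure (~` C)) ?fz //.
  apply/seteqP; split=> x; last by left.
  by case=> // -[Sx Cx]; exact: cln.
have tb := tower_tower_bot tame_next; have [cb Cb tpb] := tower_inv tb.
have nVz : ~ V z by case.
have CE : C = bot `\` V.
  apply/seteqP; split=> [x Cx|x [bx nVx]]; first by split; [exact: Cb|case].
  by apply: contrapT => nCx; apply: nVx.
have pb : pre bot = bot.
  case: tpb => // -[[ob _] _ _]; case: noC; exists z; split=> //.
  have oC : open C by rewrite CE setDE; apply: openI => //; case: (clopen_setC clV).
  by rewrite (interior_id C).1.
have goodb : prevails f bot bot.
  by move=> F cF F0 Fb; rewrite -{1}pb; exact: tower_pre_sel.
have clz : closure (~` bot) z.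
  have : closure (~` C) z by exact: cln.
  rewrite (_ : ~` C = ~` bot `|` V); last first.
    rewrite CE setDE setCI setCK.
    by [].
  rewrite closureU => -[//|]; rewrite -(closure_id V).1 //.
  by case: clV.
have fbz := prevails_boundary hX goodb (Cb _ Cz) clz.
have bT : bot <> setT.
  by move=> bE; have := clz; rewrite bE setCT closure0.
rewrite -fbz in Oh.
have [E2 [oE2 bE2 HE2]] := near_limit tb pb bT oO Oh.
have near2 : vnear S (fun B => B `&` (E2 `&` ~` V) !=set0).
  apply: vnear_meet; first by apply: openI => //; case: (clopen_setC clV).
  by exists z; split=> //; split=> //; exact: (bE2 _ (Cb _ Cz)).
move: (vnear_and near2 nearC); apply: vnear_mono => B cB B0 [[x [Bx [E2x nVx]]] HB].
have [|nBC] := pselect (B `&` C !=set0); first exact: HB.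
have BC : B `&` C = set0 by apply/seteqP; split=> // y BCy; apply: nBC; exists y.
rewrite mselT //; last by exists x.
apply: HE2.
- exact: closed_diff.
- by exists x.
- exact: bot_diff.
- by exists x.
Qed.

End MaximalSelection.

(** * Transfer to the hyperspace *)
Section Hyperspace.
Variable X : topologicalType.
Implicit Types (A B G O : set X).

Lemma hsetP (S : hyperspace X) : closed (hset S) /\ hset S !=set0.
Proof. by have := valP S; rewrite inE. Qed.

Lemma hset_surj A : closed A -> A !=set0 -> exists S : hyperspace X, hset S = A.
Proof.
move=> cA A0; have HA : A \in [set S : set X | closed S /\ S !=set0] by rewrite inE.
by exists (exist _ A HA).
Qed.

Lemma hset_inj (S S' : hyperspace X) : hset S = hset S' -> S = S'.
Proof. exact: val_inj. Qed.

Lemma nbhs_hyperspaceP (S : hyperspace X) (W : set (hyperspace X)) :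
  nbhs S W <-> exists2 V, finite_open_family V & vietoris_set V S /\ vietoris_set
    V `<=` W.
Proof.
split.
  rewrite nbhsE => -[O [[D DV <-] [V DVV VS]] OW].
  exists V; first exact: DV.
  by split=> // S' VS'; apply: OW; exists V.
move=> [V fV [VS VW]]; rewrite nbhsE; exists (vietoris_set V) => //; split=> //.
by exists [set V]; [move=> _ ->|rewrite bigcup_set1].
Qed.

Lemma vnear_hyperspace (S : hyperspace X) P :
  nbhs S [set S' | P (hset S')] <-> vnear (hset S) P.
Proof.
split.
  move=> /nbhs_hyperspaceP[V [/finite_seqP[s Vs] oV] [[SV VS] VP]].
  exists (\bigcup_(A in V) A), s; split=> //.
  - exact: bigcup_open.
  - move=> A As; have VA : V A by rewrite Vs.
    by split; [exact: oV|exact: VS].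
  - move=> B cB B0 BV Bs; have [S' S'B] := hset_surj cB B0.
    rewrite -S'B; apply: VP; rewrite /vietoris_set /= S'B; split=> // A.
    by rewrite Vs => /Bs.
move=> [G [Vs [oG SG SVs HP]]]; apply/nbhs_hyperspaceP.
exists ([set G] `|` (fun A => A `&` G) @` [set` Vs]).
  split; first by rewrite finite_setU; split=> //; apply: finite_image;
    apply/finite_seqP; exists Vs.
  by move=> _ [->//|[A /SVs[oA _] <-]]; exact: openI.
have [cS S0] := hsetP S.
split.
  split; first by move=> x /SG Gx; exists G => //; left.
  move=> _ [->|[A /SVs[_ [x [Sx Ax]]] <-]].
    by have [x Sx] := S0; exists x; split=> //; exact: SG.
  by exists x; split=> //; split=> //; exact: SG.
move=> S' [S'G HS']; have [cS' S'0] := hsetP S'.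
apply: HP => //.
  by move=> x /S'G[_ [->//|[A _ <-]] []].
move=> A AVs; have [|x [Sx [Ax _]]] := HS' (A `&` G); last by exists x.
by right; exists A.
Qed.

End Hyperspace.

Theorem theorem6p1 (X : topologicalType) (p : X)
    (X_infinite : infinite_set [set: X])
    (X_hausdorff : hausdorff_space X)
    (X_selection : exists f : hyperspace X -> X, continuous_selection f)
    (p_in : (X_Theta X `\` X_Omega X) p) :
  has_clopen_base (connected_component [set: X] p) /\ X_Theta_star X p.
Proof.
have [pTheta nOmega] := p_in.
have [phi [[phi_sel phi_cont] [ST hST phiST]]] := pTheta.
have [A|f Hf] := @choice (set X) X
    (fun A x => forall S, hset S = A -> phi S = x).
  have [[S SA]|nS] := pselect (exists S : hyperspace X, hset S = A).
    by exists (phi S) => S' S'A; congr phi; apply: hset_inj; rewrite SA.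
  by exists p => S SA; case: nS; exists S.
have fE S : phi S = f (hset S) by exact: Hf.
have f_sel : set_selection f.
  move=> A cA A0; have [S <-] := hset_surj cA A0; rewrite -fE; exact: phi_sel.
have f_cont : set_continuous f.
  move=> A O cA A0 oO; have [S <-] := hset_surj cA A0; rewrite -fE => OS.
  apply/vnear_hyperspace.
  have OphiS : nbhs S (phi @^-1` O).
    by apply: (phi_cont S O); exact: open_nbhs_nbhs.
  by apply: filterS OphiS => S' /=; rewrite fE.
have fT : f setT = p by rewrite -hST -fE.
have CE := quasi_componentE X_hausdorff f_sel f_cont p.
split.
  rewrite -CE; split; first exact: quasi_component_closed.
  move=> U /set_nbhsP[O [oO CO OU]].
  have [H [clH Hp HO]] := clopen_base_component X_hausdorff f_sel f_cont fT
    nOmega oO CO.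
  exists H; split=> //; last exact: subset_trans OU.
  by move=> x; apply.
split=> //.
pose h := maximal_selection f p.
exists (fun S => h (hset S)).
  split.
    move=> S; have [cS S0] := hsetP S.
    exact: (maximal_selection_sel X_hausdorff f_sel f_cont fT nOmega).
  move=> S O; rewrite nbhsE => -[O' [oO' O'S] O'O].
  have [cS S0] := hsetP S.
  have : nbhs S [set S' | O' (h (hset S'))].
    apply/(vnear_hyperspace S (fun B => O' (h B))).
    exact: (maximal_selection_cont X_hausdorff f_sel f_cont fT nOmega).
  by apply: filterS => S' /O'O.
move=> S Sp; have [cS S0] := hsetP S.
exact: (maximal_selection_max X_hausdorff f_sel f_cont fT nOmega).
Qed.
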